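(* Let $(X,d,\mu)$ be a metric measure space. Let $0<p<\infty$, $1<\sigma\le 2$, and let $B=B(z,R)$ be any ball of radius $R$. Assume that for some $s,b,R_o>0$, \[ \mu(B(x,r))\ge b r^s\qquad\text{for all } x\in\sigma B,\ 0<r\le R_o . \] Set $L=\min\{R_o,(\sigma-1)R\}$. Let $u\in M^{1,p}(\sigma B)$ and let $g\in D(u)\cap L^p(\sigma B)$. Below, $C_{s,p}$ denotes a positive constant depending only on $s$ and $p$, and $c_s,C_s$ denote positive constants depending only on $s$ (possibly different at each occurrence). (1) If $0<p<s$ and $p^*=\frac{sp}{s-p}$, then \[ \inf_{\gamma\in\mathbb R}\left(\frac1{\mu(B)}\int_B|u-\gamma|^{p^*}d\mu\right)^{1/p^*}\le C_{s,p}\,\frac RL\, b^{-1/p}L^{1-s/p}\Vert g\Vert_{L^p(\sigma B)} . \] If $p^*\ge1$, then one may take $\gamma=u_B$, after changing the constant. If $1\le p<s$, then, with $s'=s/(s-1)$, the following sharper estimate holds: \[ \left(\frac1{\mu(B)}\int_B|u-u_B|^{p^*}d\mu\right)^{1/p^*}\le C_s\left(\frac RL+\left(\frac{s-1}{s-p}\right)^{1/s'}\right)b^{-1/p}L^{1-s/p}\Vert g\Vert_{L^p(\sigma B)} . \] (2) If $p=s>1$ and $\Vert g\Vert_{L^s(\sigma B)}>0$, then \[ \frac1{\mu(B)}\int_B\exp\!\left[c_s\left(\frac LR\,\frac{b^{1/s}|u-u_B|}{\Vert g\Vert_{L^s(\sigma B)}}\right)^{\frac{s}{s-1}}\right]d\mu\le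 C_s . \] If $p=s\le1$, then $u|_B$ has a uniformly continuous representative that satisfies \[ \operatorname{osc}_B u\le C_s\,\frac RL\, b^{-1/s}\Vert g\Vert_{L^s(\sigma B)} . \] (3) If $p>s$, then $u|_B$ has a Hölder continuous representative of order $1-s/p$ that satisfies \[ \operatorname{osc}_B u\le C_{s,p}\,\frac RL\, b^{-1/p}L^{1-s/p}\Vert g\Vert_{L^p(\sigma B)} \] and \[ |u(x)-u(y)|\le C_{s,p}\,\frac RL\, b^{-1/p}d(x,y)^{1-s/p}\Vert g\Vert_{L^p(\sigma B)}\qquad\text{for all }x,y\in B . \]
   Context: A metric measure space $(X,d,\mu)$ is a metric space $(X,d)$ with at least two points, equipped with a Borel measure $\mu$ such that $0<\mu(B(x,r))<\infty$ for all $x\in X$, $r\in(0,\infty)$. $B(x,r)$ is the open ball in $X$; a ball $B=B(z,R)$ comes with a fixed center $z$ and radius $R>0$, and $\sigma B=B(z,\sigma R)$. For a measurable set $A\subset X$ (here $A=\sigma B$, with the restricted metric and measure) and a measurable function $u$ on $A$, $D(u)$ is the class of measurable functions $g\ge0$ on $A$ for which there is a set $N\subset A$ with $\mu(N)=0$ such that $|u(x)-u(y)|\le d(x,y)(g(x)+g(y))$ for all $x,y\in A\setminus N$. $M^{1,p}(A)$ is the set of all $u\in L^p(A)$ such that $D(u)\cap L^p(A)\neq\varnothing$. $\Vert f\Vert_{L^p(A)}=(\int_A|f|^p\,d\mu)^{1/p}$ (a quasinorm when $p<1$). $u_B=\mu(B)^{-1}\int_B u\,d\mu$. For a real-valued function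 $v$ on a set $A$, $\operatorname{osc}_A v=\sup_A v-\inf_A v$. A representative of $u|_B$ is a function on $B$ that equals $u$ $\mu$-almost everywhere on $B$; in (2) (case $p=s\le 1$) and (3) the inequalities are for this representative. *)

(* Defs.v *)
From HB Require Import structures.
From mathcomp Require Import all_boot all_order all_algebra.
From mathcomp Require Import all_classical all_reals all_analysis.

Set Implicit Arguments.
Unset Strict Implicit.
Unset Printing Implicit Defensive.

Import Order.TTheory GRing.Theory Num.Theory.
Import numFieldNormedType.Exports.

Local Open Scope classical_set_scope.
Local Open Scope ring_scope.

(* A metric space together with its Borel sigma-algebra.  Measurable types
   carry a distinguished point, so X is nonempty. *)
HB.mixin Record isBorelMetric (d : measure_display) (R : realType) T
    & Measurable d T & Metric R T := {
  borel_measurableE : @measurable d T = <<s [set U : set T | open U] >>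
}.

#[short(type="borelMetricType")]
HB.structure Definition BorelMetric (d : measure_display) (R : realType) :=
  {T of Measurable d T & Metric R T & isBorelMetric d R T}.

Section sobolev.
Context (d : measure_display) (R : realType) (X : borelMetricType d R).
Variable mu : {measure set X -> \bar R}.
Implicit Types (A N : set X) (u v f g : X -> R) (p a : R).

Definition metric_measure_space : Prop :=
  (exists x y : X, x <> y) /\
  forall (x : X) (r : R), 0 < r -> (0 < mu (ball x r) < +oo)%E.

Definition Lpnorm A p f : \bar R :=
  ((\int[mu]_(x in A) ((`|f x| `^ p)%:E)) `^ p^-1)%E.

(* Only the values on A matter; the exponent p may be smaller than 1. *)
Definition Lp A p : set (X -> R) :=
  [set f : X -> R | measurable_fun A f /\ (Lpnorm A p f < +oo)%E].

Definition hajlasz_gradient A u : set (X -> R) :=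
  [set g : X -> R | [/\ measurable_fun A g, forall x, A x -> 0 <= g x &
    exists N, [/\ N `<=` A, mu.-negligible N &
      forall x y, (A `\` N) x -> (A `\` N) y ->
        `|u x - u y| <= mdist x y * (g x + g y)]]].

Definition M1p A p : set (X -> R) :=
  [set u : X -> R | Lp A p u /\ hajlasz_gradient A u `&` Lp A p !=set0].

Definition avg A (f : X -> \bar R) : \bar R :=
  ((mu A)^-1 * \int[mu]_(x in A) f x)%E.

(* Meaningful when u is integrable on A. *)
Definition mean A u : R := fine (avg A (EFin \o u)).

(* Extended-real valued, so that it is +oo when v is unbounded on A. *)
Definition osc A v : \bar R :=
  (ereal_sup [set (v x)%:E | x in A] - ereal_inf [set (v x)%:E | x in A])%E.

Definition representative A u v : Prop :=
  {ae mu, forall x, A x -> v x = u x}.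

Definition unif_continuous_on A v : Prop :=
  unif_continuous (v : subspace A -> R).

Definition hoelder_continuous_on A a v : Prop :=
  exists K : R, forall x y, A x -> A y -> `|v x - v y| <= K * mdist x y `^ a.

End sobolev.

(* Main.v *)
Require Import Defs.
From HB Require Import structures.
From mathcomp Require Import all_boot all_order all_algebra.
From mathcomp Require Import all_classical all_reals all_analysis.
From mathcomp Require Import measurable_realfun ring lra.
Import Order.TTheory GRing.Theory Num.Theory.
Import numFieldNormedType.Exports.
Local Open Scope classical_set_scope.
Local Open Scope ring_scope.

(** Let m be comparable to b^(-1/p) L^(-s/p) ||g||_p.  The lower bound on the
    measure of balls makes a ball with radius rho_j, b rho_j^s > mu {g > m 2^j},
    around any point meet {g <= m 2^j}, and Chebyshev's inequality makes the
    sum of the rho_j at most L.  Hence a point x of B with g x <= m 2^k starts a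
    chain of points in sigma B, the j-th one in {g <= m 2^j}, that ends in
    {g <= m}, and along it u changes by at most 3 m sum_(j < k) 2^j rho_j.  On
    {g <= m} the function u is 2m-Lipschitz, so it oscillates by at most 8 m R
    there: this is where the factor R / L comes from.  By layer cake,
    b sum_j (m 2^j)^p rho_j^s <= C ||g||_p^p.  All cases follow by estimating
    sum_(j < k) 2^j rho_j: a geometric sum when p <> s, Hoelder's inequality for
    the sharp bound and for p = s > 1 (where it gives k^(1/s'), hence
    exponential integrability), and the embedding of l^s into l^1 for
    p = s <= 1.  For p < s one integrates over B, using that 2^k is at most
    1 + 2 g x / m.  The norm of g may vanish, so the estimates are proved with
    any G > ||g||_p instead and G tends to ||g||_p at the end. *)

(** * Real sums *)

Section real_sums.
Context {R : realType}.
Implicit Types (a c p q s t A C : R) (k : nat) (x y : nat -> R).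

Lemma powR_exprn a p k : 0 <= a -> (a ^+ k) `^ p = (a `^ p) ^+ k.
Proof.
move=> a0; rewrite -(powR_mulrn k a0) -(powR_mulrn k (powR_ge0 a p)).
exact: powRAC.
Qed.

Lemma powR_div a c p : 0 <= a -> 0 <= c -> (a / c) `^ p = a `^ p / c `^ p.
Proof.
move=> a0 c0; rewrite powRM ?invr_ge0//; congr (_ * _).
by rewrite -powR_inv1// -powRrM mulN1r powRN.
Qed.

Lemma ler_powRl p a c : 0 <= p -> 0 <= a -> a <= c -> a `^ p <= c `^ p.
Proof.
by move=> p0 a0 ac; apply: ge0_ler_powR => //; rewrite nnegrE// (le_trans a0).
Qed.

Lemma powR_gt1 a p : 1 < a -> 0 < p -> 1 < a `^ p.
Proof.
move=> a1 p0; have <- : 1 `^ p = 1 :> R by rewrite powR1.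
by rewrite gt0_ltr_powR// nnegrE; lra.
Qed.

Lemma powR2N_lt1 p : 0 < p -> 2 `^ (- p) < 1 :> R.
Proof. by move=> p0; rewrite powRN invf_lt1 ?powR_gt0// powR_gt1// ltr1n. Qed.

Lemma powR_addl_le p a c : 0 <= p -> 0 <= a -> 0 <= c ->
  (a + c) `^ p <= 2 `^ p * (a `^ p + c `^ p).
Proof.
move=> p0 a0 c0; wlog ac : a c a0 c0 / a <= c.
  by case: (leP a c) => [?|/ltW ?] h; [|rewrite addrC [in leRHS]addrC]; exact: h.
apply: (@le_trans _ _ ((2 * c) `^ p)); first by apply: ler_powRl => //; lra.
by rewrite powRM// ler_wpM2l ?powR_ge0// lerDr powR_ge0.
Qed.

Lemma le_mul_pow2 a c : 0 < c -> exists k, a <= c * 2 ^+ k.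
Proof.
move=> c0; exists (Num.bound (`|a| / c)).
have := archi_boundP (divr_ge0 (normr_ge0 a) (ltW c0)).
set k := Num.bound _; rewrite ltr_pdivrMr// mulrC => h.
apply: (le_trans (ler_norm _)); apply: (le_trans (ltW h)).
by rewrite ler_wpM2l ?(ltW c0)// -natrX ler_nat ltnW// ltn_expl.
Qed.

Lemma sum_geometric_le a k : 1 < a ->
  \sum_(0 <= j < k) a ^+ j <= a ^+ k / (a - 1).
Proof.
move=> a1; rewrite ler_pdivlMr ?subr_gt0// mulrC big_mkord -subrX1.
by rewrite lerBlDr lerDl.
Qed.

Lemma sum_geometric_le1 a k : 0 <= a < 1 ->
  (1 - a) * \sum_(0 <= j < k) a ^+ j <= 1.
Proof.
move=> /andP[a0 a1]; rewrite big_mkord -opprB mulNr -subrX1 opprB.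
by rewrite lerBlDr lerDl exprn_ge0.
Qed.

(** The terms below [t] form an initial segment of a geometric progression, so their sum is at most
    [a / (a - 1)] times the last of them, which is itself below [t]. This is a discrete layer-cake
    bound. *)
Lemma sum_geometric_below_le a c t k : 1 < a -> 0 <= c -> 0 <= t ->
  \sum_(0 <= j < k) (if c * a ^+ j < t then c * a ^+ j else 0)
    <= t * (a / (a - 1)).
Proof.
move=> a1 c0 t0; have a0 : 0 < a - 1 by rewrite subr_gt0.
elim: k => [|k IH]; first by rewrite big_geq// mulr_ge0// divr_ge0//; lra.
rewrite big_nat_recr//=; case: ifPn => [ct|_]; last by rewrite addr0.
apply: (@le_trans _ _ (c * (\sum_(0 <= j < k.+1) a ^+ j))).
  rewrite big_nat_recr//= mulrDr lerD2r big_distrr/=; apply: ler_sum => j _.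
  by case: ifPn => // _; rewrite mulr_ge0// exprn_ge0//; lra.
apply: (@le_trans _ _ (c * (a ^+ k.+1 / (a - 1)))).
  by rewrite ler_wpM2l// sum_geometric_le.
have -> : c * (a ^+ k.+1 / (a - 1)) = c * a ^+ k * (a / (a - 1)).
  by rewrite exprSr !mulrA.
by rewrite ler_wpM2r ?(ltW ct)// divr_ge0//; lra.
Qed.

(** After division by A^(1/s) C^(1/q), Young's inequality term by term leaves a sum of at most 1/s +
    1/q = 1. *)
Lemma sum_hoelder k x y s q A C : (forall j, 0 <= x j) ->
  (forall j, 0 <= y j) -> 0 < s -> 0 < q -> s^-1 + q^-1 = 1 -> 0 < A -> 0 < C ->
  \sum_(0 <= j < k) x j `^ s <= A -> \sum_(0 <= j < k) y j `^ q <= C ->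
  \sum_(0 <= j < k) x j * y j <= A `^ s^-1 * C `^ q^-1.
Proof.
move=> x0 y0 s0 q0 sq A0 C0 xA yC.
have A1 : 0 < A `^ s^-1 by rewrite powR_gt0.
have C1 : 0 < C `^ q^-1 by rewrite powR_gt0.
rewrite -[leRHS]mulr1 -ler_pdivrMl ?mulr_gt0// big_distrr/=.
apply: (@le_trans _ _
  (\sum_(0 <= j < k) (x j `^ s / A / s + y j `^ q / C / q))).
  apply: ler_sum => j _.
  have -> : (A `^ s^-1 * C `^ q^-1)^-1 * (x j * y j) =
    (x j / A `^ s^-1) * (y j / C `^ q^-1) by rewrite invfM; ring.
  have := @conjugate_powR _ (x j / A `^ s^-1) (y j / C `^ q^-1) s q.
  rewrite !powR_div ?powR_ge0// -!powRrM !mulVf ?gt_eqF//.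
  by rewrite (powRr1 (ltW A0)) (powRr1 (ltW C0)) => ->//; rewrite divr_ge0// ltW.
rewrite big_split/= -!big_distrl/= -[leRHS]sq lerD//.
  by rewrite -[leRHS]mul1r ler_wpM2r ?invr_ge0 ?(ltW s0)// ler_pdivrMr// mul1r.
by rewrite -[leRHS]mul1r ler_wpM2r ?invr_ge0 ?(ltW q0)// ler_pdivrMr// mul1r.
Qed.

(** Each quotient [x j] / A^(1/s) is at most 1, hence at most its own s-th power because s <= 1; the
    s-th powers sum to at most 1. *)
Lemma sum_le_powR_sum k x s A : (forall j, 0 <= x j) -> 0 < s <= 1 -> 0 < A ->
  \sum_(0 <= j < k) x j `^ s <= A -> \sum_(0 <= j < k) x j <= A `^ s^-1.
Proof.
move=> x0 /andP[s0 s1] A0 xA.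
have A1 : 0 < A `^ s^-1 by rewrite powR_gt0.
rewrite -[leRHS]mul1r -ler_pdivrMr// big_distrl/=.
apply: (@le_trans _ _ (\sum_(0 <= j < k) x j `^ s / A)); last first.
  by rewrite -big_distrl/= ler_pdivrMr// mul1r.
apply: ler_sum_nat => j /andP[_ jk].
have xjA : x j `^ s <= A.
  apply: le_trans xA; rewrite big_mkord (bigD1 (Ordinal jk))//= lerDl.
  by apply: sumr_ge0 => i _; rewrite powR_ge0.
have {}xjA : x j <= A `^ s^-1.
  have := ler_powRl s^-1 _ _ _ (powR_ge0 _ _) xjA.
  by rewrite -powRrM mulfV ?gt_eqF// powRr1// => -> //; rewrite invr_ge0 ltW.
have -> : x j `^ s / A = (x j / A `^ s^-1) `^ s.
  by rewrite powR_div ?powR_ge0// -powRrM mulVf ?gt_eqF// powRr1// ltW.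
have [->|xj0] := eqVneq (x j) 0; first by rewrite mul0r powR_ge0.
apply: ger1_powR => //; rewrite divr_gt0 ?ler_pdivrMr ?mul1r//.
by rewrite lt_neqAle eq_sym xj0 x0.
Qed.

(** [k0] is an index whose partial sum is within [e] of the supremum of all partial sums. *)
Lemma bounded_sum_tail x A e : (forall j, 0 <= x j) ->
  (forall k, \sum_(0 <= j < k) x j <= A) -> 0 < e ->
  exists k0, forall k, \sum_(k0 <= j < k) x j <= e.
Proof.
move=> x0 xA e0; pose S := [set \sum_(0 <= j < k) x j | k in [set: nat]].
have Ssup : has_sup S.
  by split; [exists (\sum_(0 <= j < 0) x j); exists 0%N|exists A => _ [k _ <-]].
have [_ [k0 _ <-] lt] := @sup_adherent _ S e e0 Ssup.
exists k0 => k; have [kk|/ltnW kk] := leqP k k0.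
  by rewrite big_geq// ltW.
have : \sum_(0 <= j < k) x j <= sup S by apply: sup_upper_bound => //; exists k.
rewrite (@big_cat_nat _ _ _ k0)//=; move: lt; rewrite ltrBlDr.
set P := bigop _ _ _; set Q := bigop _ _ _; lra.
Qed.

End real_sums.

(** * Constants and levels *)

Section level.
Context {R : realType}.
Implicit Types s p b l G : R.

(** Chebyshev's inequality bounds b rho_j^s by a multiple of 2^(-jp); this is the resulting ratio of
    the bounds on consecutive radii. *)
Definition decay s p : R := 2 `^ (- (p / s)).

Definition level_cst s p : R := (2 / (1 - decay s p) `^ s) `^ p^-1.

(* By Chebyshev, superlevel sets of g above [level s p b l G] are too small to
   contain a ball of radius comparable to l. *)
Definition level s p b l G : R :=
  level_cst s p * G * b `^ (- p^-1) * l `^ (- (s / p)).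

(** The quotient comes from the layer-cake bound, the 2 from the positive amounts that are added to
    the measures in [superlevel_radii]. *)
Definition radii_cst p : R := 2 `^ p / (2 `^ p - 1) + 2.

(* Radii of a chain of balls through the superlevel sets of g, relative to l. *)
Definition profile s p (y : nat -> R) : Prop := [/\ forall j, 0 <= y j,
  forall j, y j <= (1 - decay s p) * decay s p ^+ j &
  forall k, \sum_(0 <= j < k) (2 ^+ j) `^ p * y j `^ s <= radii_cst p].

Lemma decay_gt0 s p : 0 < decay s p. Proof. exact: powR_gt0. Qed.

Lemma decay_lt1 s p : 0 < s -> 0 < p -> decay s p < 1.
Proof. by move=> s0 p0; rewrite powR2N_lt1// divr_gt0. Qed.

Lemma decay_powR s p : 0 < s -> decay s p `^ s = 2 `^ (- p).
Proof. by move=> s0; rewrite -powRrM mulNr divfK// gt_eqF. Qed.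

Lemma level_cst_gt0 s p : 0 < s -> 0 < p -> 0 < level_cst s p.
Proof.
by move=> s0 p0; rewrite powR_gt0// divr_gt0// powR_gt0 ?subr_gt0// decay_lt1.
Qed.

Lemma level_gt0 s p b l G : 0 < s -> 0 < p -> 0 < b -> 0 < l -> 0 < G ->
  0 < level s p b l G.
Proof. by move=> *; rewrite !mulr_gt0 ?level_cst_gt0 ?powR_gt0. Qed.

(** [level_cst] is made for this identity: with m the level, the bound b (m 2^j)^p rho_j^s <= 2 G^p
    becomes rho_j <= (1 - decay) l decay^j, a geometric sequence with sum at most l. *)
Lemma level_powR s p b l G : 0 < s -> 0 < p -> 0 < b -> 0 < l -> 0 < G ->
  b * level s p b l G `^ p * ((1 - decay s p) * l) `^ s = 2 * G `^ p.
Proof.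
move=> s0 p0 b0 l0 G0; have T1 : 0 < 1 - decay s p by rewrite subr_gt0 decay_lt1.
have p1 : p != 0 by rewrite gt_eqF.
rewrite /level !powRM ?(powR_ge0, mulr_ge0) ?(ltW T1) ?ltW// -!powRrM.
rewrite mulVf// mulNr mulVf// mulNr divfK// powRr1 ?divr_ge0 ?powR_ge0//.
rewrite !powRN powRr1 ?ltW//.
have := powR_gt0 s T1; have := powR_gt0 s l0; set x := l `^ s; set y := _ `^ s.
move=> x0 y0; field; rewrite !gt_eqF//.
Qed.

Lemma radii_cst_gt0 p : 0 < p -> 0 < radii_cst p.
Proof.
move=> p0; rewrite addr_gt0// divr_gt0 ?powR_gt0// subr_gt0.
by rewrite powR_gt1// ltr1n.
Qed.

(** The sharp estimate allows constants in s alone, so p has to disappear from [radii_cst]. *)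
Lemma radii_cst_le4 p : 1 <= p -> radii_cst p <= 4.
Proof.
move=> p1; have : 2 <= 2 `^ p :> R by rewrite -[leLHS]powRr1// ler_powR// ler1n.
rewrite /radii_cst; set a := 2 `^ p => a2.
have : a / (a - 1) <= 2 by rewrite ler_pdivrMr; lra.
lra.
Qed.

Lemma level_mul s p b l G : 0 < l ->
  level s p b l G * l = level_cst s p * G * b `^ (- p^-1) * l `^ (1 - s / p).
Proof.
move=> l0; rewrite /level -mulrA; congr (_ * _).
by rewrite mulrC (powRD (r := 1)) ?(gt_eqF l0) ?implybT// powRr1// ltW.
Qed.

Lemma level_cst_le s p : 1 <= p -> p <= s ->
  level_cst s p <= 2 / (1 - 2 `^ (- s^-1)) `^ s.
Proof.
move=> p1 ps; have p0 : 0 < p by lra.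
have s0 : 0 < s by lra.
have t1 : 2 `^ (- s^-1) < 1 :> R by rewrite powR2N_lt1 ?invr_gt0.
have h : 2 / (1 - decay s p) `^ s <= 2 / (1 - 2 `^ (- s^-1)) `^ s.
  have d1 : 0 < (1 - decay s p) `^ s by rewrite powR_gt0// subr_gt0 decay_lt1.
  have d2 : 0 < (1 - 2 `^ (- s^-1)) `^ s :> R by rewrite powR_gt0// subr_gt0.
  apply: (ler_wpM2l (ler0n _ 2)).
  have dd : (1 - 2 `^ (- s^-1)) `^ s <= (1 - decay s p) `^ s; last first.
    by rewrite (lef_pV2 d1 d2).
  apply: ler_powRl; [exact: ltW|by rewrite subr_ge0 ltW|].
  rewrite lerD2l lerN2 /decay ler_powR ?ler1n// lerN2.
  by rewrite -[leLHS]mul1r ler_wpM2r// invr_ge0 ltW.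
apply: le_trans h; rewrite /level_cst.
have T1 := decay_lt1 s p s0 p0; have T0 := decay_gt0 s p.
have h1 : 1 <= 2 / (1 - decay s p) `^ s.
  rewrite ler_pdivlMr ?powR_gt0 ?subr_gt0// mul1r.
  apply: (@le_trans _ _ (1 `^ s)); last by rewrite powR1 ler1n.
  by apply: ler_powRl; [exact: ltW|rewrite subr_ge0 ltW|rewrite gerBl ltW].
by rewrite -[leRHS]powRr1 ?(le_trans _ h1)// ler_powR// invf_le1.
Qed.

(** Bounds the average over B of (1 + 2 g / m)^p, see [integral_weight]. *)
Definition weight_cst p : R := 2 `^ p * (1 + 2 `^ p).

(* The absolute values make the constants below positive also for values of
   s and p that the theorem does not use. *)
Definition inf_cst s p : R := let q := s * p / (s - p) in
  1 + `|level_cst s p * (8 + 3 * (2 `^ (1 - p / s) - 1)^-1)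
        * weight_cst p `^ q^-1|.

Definition mean_cst s p : R := let q := s * p / (s - p) in
  1 + `|level_cst s p * (8 + 3 * (2 `^ (1 - p / s) - 1)^-1)
        * (1 + weight_cst p) * weight_cst p `^ q^-1|.

Definition sharp_cst s : R :=
  1 + `|24 * (2 / (1 - 2 `^ (- s^-1)) `^ s) * (1 + weight_cst s) * weight_cst s|.

(** With this rate the exponential is at most 2^(k+1) at a point whose chain has k steps. *)
Definition exp_rate s : R :=
  ln 2 / (1 + `|20 * level_cst s s * (1 + weight_cst s)|) `^ (s / (s - 1)).

Definition exp_cst s : R := 2 * weight_cst s.

Definition critical_osc_cst s : R :=
  1 + `|level_cst s s * (10 * radii_cst s `^ s^-1 + 4)|.

Definition osc_cst s p : R :=
  1 + `|level_cst s p * (10 * (1 - 2 `^ (1 - p / s))^-1 + 4)|.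

End level.

(** * Bounds for the sums of 2^j y_j over a profile y, in each range of s and p *)

Section oscillation_sums.
Context {R : realType}.
Implicit Types (t : R) (k : nat).
Context (s p : R) (y : nat -> R) (s0 : 0 < s) (p0 : 0 < p).
Context (yP : profile s p y).

Let y0 : forall j, 0 <= y j. Proof. by case: yP. Qed.
Let yT : forall j, y j <= (1 - decay s p) * decay s p ^+ j.
Proof. by case: yP. Qed.
Let ysum : forall k,
  \sum_(0 <= j < k) (2 ^+ j) `^ p * y j `^ s <= radii_cst p.
Proof. by case: yP. Qed.

Lemma two_decay : 2 * decay s p = 2 `^ (1 - p / s).
Proof.
by rewrite powRD ?powRr1// ?pnatr_eq0 ?implybT//.
Qed.

Let y_le j : 2 ^+ j * y j <= (2 `^ (1 - p / s)) ^+ j.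
Proof.
rewrite -two_decay exprMn ler_wpM2l ?exprn_ge0//; apply: le_trans (yT j) _.
rewrite ler_piMl ?exprn_ge0 ?(ltW (decay_gt0 _ _))//.
by rewrite lerBlDr lerDl ltW// decay_gt0.
Qed.

Lemma oscillation_sum_lt k : p < s ->
  \sum_(0 <= j < k) 2 ^+ j * y j
    <= (2 `^ (1 - p / s) - 1)^-1 * (2 ^+ k) `^ (1 - p / s).
Proof.
move=> ps; rewrite mulrC powR_exprn//.
apply: (@le_trans _ _ (\sum_(0 <= j < k) (2 `^ (1 - p / s)) ^+ j)).
  by apply: ler_sum => j _; exact: y_le.
by rewrite sum_geometric_le// powR_gt1 ?ltr1n// subr_gt0 ltr_pdivrMr ?mul1r.
Qed.

Lemma oscillation_sum_gt k : s < p ->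
  \sum_(0 <= j < k) 2 ^+ j * y j <= (1 - 2 `^ (1 - p / s))^-1.
Proof.
move=> sp; have a1 : 2 `^ (1 - p / s) < 1 :> R.
  by rewrite -opprB powR2N_lt1// subr_gt0 ltr_pdivlMr ?mul1r.
apply: (@le_trans _ _ (\sum_(0 <= j < k) (2 `^ (1 - p / s)) ^+ j)).
  by apply: ler_sum => j _; exact: y_le.
rewrite -[leRHS]mul1r ler_pdivlMr ?subr_gt0// mulrC.
by rewrite sum_geometric_le1// a1 powR_ge0.
Qed.

Lemma oscillation_sum_eq_le1 k : p = s -> s <= 1 ->
  \sum_(0 <= j < k) 2 ^+ j * y j <= radii_cst s `^ s^-1.
Proof.
move=> ps s1; apply: (@sum_le_powR_sum _ _ _ s).
- by move=> j; rewrite mulr_ge0 ?exprn_ge0.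
- by rewrite s0.
- exact: radii_cst_gt0.
- rewrite -{2}ps; apply: le_trans (ysum k).
  by apply: ler_sum => j _; rewrite powRM ?exprn_ge0// ps.
Qed.

(** The terms are split as (2^(jp/s) y_j) times 2^(j(1 - p/s)). The s-th powers of the first factors
    are those bounded in [profile] by [radii_cst p], which is at most 4. *)
Let hoelder_split q C k : 1 <= p -> 1 < s -> q = s / (s - 1) -> 0 < C ->
  \sum_(0 <= j < k) ((2 ^+ j) `^ (1 - p / s)) `^ q <= C ->
  \sum_(0 <= j < k) 2 ^+ j * y j <= 4 * C `^ q^-1.
Proof.
move=> p1 s1 qE C0 hC; have s10 : 0 < s - 1 by rewrite subr_gt0.
have q0 : 0 < q by rewrite qE divr_gt0.
apply: (@le_trans _ _ (radii_cst p `^ s^-1 * C `^ q^-1)); last first.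
  rewrite ler_wpM2r ?powR_ge0//; apply: (@le_trans _ _ (4 `^ s^-1)).
    rewrite ler_powRl ?radii_cst_le4 ?(ltW (radii_cst_gt0 _ _)) ?invr_ge0//.
    exact: ltW.
  by rewrite -[leRHS]powRr1// ler_powR ?ler1n// invf_le1// ltW.
have -> : \sum_(0 <= j < k) 2 ^+ j * y j =
    \sum_(0 <= j < k) ((2 ^+ j) `^ (p / s) * y j) * (2 ^+ j) `^ (1 - p / s).
  apply: eq_bigr => j _; rewrite mulrAC -powRD ?addrNK ?subrKC ?powRr1 ?exprn_ge0//.
  by rewrite gt_eqF ?exprn_gt0// implybT.
apply: (@sum_hoelder _ _ _ _ s q) => //.
- by move=> j; rewrite mulr_ge0 ?powR_ge0.
- by rewrite qE invf_div -[X in X + _]mul1r -mulrDl subrKC mulfV// gt_eqF.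
- exact: radii_cst_gt0.
- apply: le_trans (ysum k); apply: ler_sum => j _.
  by rewrite powRM ?powR_ge0// -powRrM divfK// gt_eqF.
Qed.

(** In Hoelder's inequality the second factors give a geometric sum of ratio 2^th with th = (s -
    p)/(s - 1). Its constant 1/(2^th - 1) is at most 2/th, and the power 1/s' of 1/th is the factor
    that blows up as p tends to s. *)
Lemma oscillation_sum_sharp k : 1 <= p < s ->
  \sum_(0 <= j < k) 2 ^+ j * y j <=
    8 * ((s - 1) / (s - p)) `^ (s / (s - 1))^-1 * (2 ^+ k) `^ (1 - p / s).
Proof.
move=> /andP[p1 ps]; have s1 : 1 < s by exact: le_lt_trans ps.
have s10 : 0 < s - 1 by rewrite subr_gt0.
have sp0 : 0 < s - p by rewrite subr_gt0.
pose q := s / (s - 1); have q0 : 0 < q by rewrite divr_gt0.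
have q1 : 1 <= q by rewrite ler_pdivlMr// mul1r gerBl.
pose th := (s - p) / (s - 1); have th0 : 0 < th by rewrite divr_gt0.
have thE : (1 - p / s) * q = th by rewrite /th /q; field; rewrite !gt_eqF.
(* 2^th = exp(th ln 2) >= 1 + th ln 2, and ln 2 >= 1/2 follows from ln(1 - 1/2) <= -1/2. *)
have th2 : th / 2 <= 2 `^ th - 1.
  rewrite lerBrDl /powR pnatr_eq0/=; apply: le_trans (expR_ge1Dx _).
  rewrite lerD2l ler_pM2l//.
  have := @le_ln1Dx R (- 2^-1); rewrite (_ : 1 - 2^-1 = 2^-1); last by lra.
  by rewrite lnV ?posrE//; move=> h; have := h ltac:(lra); lra.
pose C := 2 * th^-1 * (2 ^+ k) `^ th.
have C0 : 0 < C by rewrite !mulr_gt0 ?invr_gt0// powR_gt0// exprn_gt0.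
apply: (@le_trans _ _ (4 * C `^ q^-1)).
  apply: hoelder_split => //.
  have -> : \sum_(0 <= j < k) ((2 ^+ j) `^ (1 - p / s)) `^ q =
      \sum_(0 <= j < k) (2 `^ th) ^+ j :> R.
    by apply: eq_bigr => j _; rewrite -powRrM thE powR_exprn.
  apply: (le_trans (@sum_geometric_le _ _ _ _)); first by rewrite powR_gt1 ?ltr1n.
  rewrite mulrC /C powR_exprn// ler_wpM2r ?exprn_ge0 ?powR_ge0//.
  have d0 : 0 < 2 `^ th - 1 by lra.
  rewrite -[2 * th^-1]invrK lef_pV2 ?posrE ?invr_gt0 ?mulr_gt0 ?invr_gt0//.
  by rewrite invfM invrK mulrC.
have -> : C `^ q^-1 =
    2 `^ q^-1 * ((s - 1) / (s - p)) `^ q^-1 * (2 ^+ k) `^ (1 - p / s).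
  have h0 : 0 <= th^-1 by rewrite invr_ge0 ltW.
  rewrite /C (@powRM _ (2 * th^-1)) ?powR_ge0 ?mulr_ge0// (@powRM _ 2 th^-1)//.
  rewrite -powRrM -{2}thE mulfK ?gt_eqF//.
  by rewrite /th (invf_div (s - p)).
rewrite -/q !mulrA; apply: ler_wpM2r; first exact: powR_ge0.
apply: ler_wpM2r; first exact: powR_ge0.
have : 2 `^ q^-1 <= 2 :> R by rewrite -[leRHS]powRr1// ler_powR ?ler1n// invf_le1.
lra.
Qed.

Lemma oscillation_sum_eq_gt1 k : p = s -> 1 < s ->
  \sum_(0 <= j < k) 2 ^+ j * y j <= 4 * (k%:R + 1) `^ (s / (s - 1))^-1.
Proof.
(* For p = s all second factors equal 1 and sum to k; the bound k + 1 is used because it stays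
   positive for k = 0. *)
move=> ps s1; apply: hoelder_split => //; first by rewrite ps ltW.
have -> : \sum_(0 <= j < k) ((2 ^+ j) `^ (1 - p / s)) `^ (s / (s - 1)) =
    \sum_(0 <= j < k) 1 :> R.
  by apply: eq_bigr => j _; rewrite ps divff ?gt_eqF// subrr powRr0 powR1.
by rewrite sumr_const_nat subn0 lerDl.
Qed.

End oscillation_sums.

(** * Superlevel sets *)

Section superlevel.
Context {d : measure_display} {R : realType} {X : measurableType d}.
Variable mu : {measure set X -> \bar R}.

(** The bound for a single j is Chebyshev's inequality. For the sum, the numbers (m 2^j)^p that are
    below g(x)^p form a geometric progression of ratio 2^p at each x, so [sum_geometric_below_le]
    can be integrated. *)
Lemma superlevel_measure (D : set X) (g : X -> R) (p m I : R) :
  measurable D -> measurable_fun D g -> (forall x, D x -> 0 <= g x) ->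
  0 < p -> 0 < m -> (\int[mu]_(x in D) (`|g x| `^ p)%:E <= I%:E)%E ->
  exists w : nat -> R, [/\ forall j, 0 <= w j,
    forall j, mu (D `&` [set x | m * 2 ^+ j < g x]) = (w j)%:E,
    forall j, (m * 2 ^+ j) `^ p * w j <= I &
    forall k, \sum_(0 <= j < k) (m * 2 ^+ j) `^ p * w j
      <= I * (2 `^ p / (2 `^ p - 1))].
Proof.
move=> mD mg g0 p0 m0 gI.
pose F j := D `&` [set x | m * 2 ^+ j < g x].
pose c j := (m * 2 ^+ j) `^ p.
have c0 j : 0 < c j by rewrite powR_gt0// mulr_gt0// exprn_gt0.
have mF j : measurable (F j).
  have -> : F j = D `&` [set x | (m * 2 ^+ j)%:E < (g x)%:E]%E.
    by apply/seteqP; split => x [Dx]/=; rewrite lte_fin.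
  by apply: emeasurable_fun_o_infty => //; exact/measurable_EFinP.
have mgp : measurable_fun D (fun x => (`|g x| `^ p)%:E).
  apply/measurable_EFinP; apply: (measurableT_comp (measurable_powR p)).
  exact: measurableT_comp.
have mind j : measurable_fun D (fun x => ((c j)%:E * (\1_(F j) x)%:E)%E).
  apply: measurable_funeM; apply/measurable_EFinP.
  exact: measurable_funTS.
have ind0 j x : (0 <= (c j)%:E * (\1_(F j) x)%:E)%E.
  by rewrite mule_ge0// lee_fin// ltW.
have intF j : (\int[mu]_(x in D) ((c j)%:E * (\1_(F j) x)%:E) =
    (c j)%:E * mu (F j))%E.
  rewrite ge0_integralZl_EFin ?(ltW (c0 j))//; last first.
    by apply/measurable_EFinP; exact: measurable_funTS.
  by rewrite integral_indic// setIC setIA setIid.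
have lt_pow x j : D x -> (m * 2 ^+ j < g x) = (c j < `|g x| `^ p).
  move=> Dx; rewrite ger0_norm ?g0//.
  have mj : 0 <= m * 2 ^+ j by rewrite mulr_ge0 ?exprn_ge0// ltW.
  apply/idP/idP => [lt|]; first by rewrite gt0_ltr_powR// nnegrE ?g0.
  by apply: contraTT; rewrite -!leNgt => le; rewrite ler_powRl ?g0// ltW.
have cF j : ((c j)%:E * mu (F j) <= I%:E)%E.
  rewrite -intF; apply: le_trans gI; apply: ge0_le_integral => //.
  move=> x Dx; rewrite -EFinM lee_fin indicE.
  case: (boolP (x \in F j)) => [|_]; last by rewrite mulr0 powR_ge0.
  by rewrite inE => -[_ /=]; rewrite mulr1 lt_pow// => /ltW.
have Ffin j : mu (F j) \is a fin_num.
  rewrite ge0_fin_numE//; have := cF j; case: (mu (F j)) => [r| |]//.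
    by rewrite ltry.
  by rewrite gt0_muley ?lte_fin// leye_eq.
have Fw j : mu (F j) = (fine (mu (F j)))%:E by rewrite fineK.
exists (fun j => fine (mu (F j))); split => // [j|k].
- by have := cF j; rewrite Fw -EFinM lee_fin.
- rewrite -lee_fin -sumEFin.
  apply: (@le_trans _ _ (\int[mu]_(x in D)
      (\sum_(0 <= j < k) ((c j)%:E * (\1_(F j) x)%:E)))%E).
    rewrite ge0_integral_sum//; apply: lee_sum => j _.
    by rewrite intF EFinM -Fw.
  set a := 2 `^ p; have a1 : 1 < a by rewrite powR_gt1// ltr1n.
  have a0 : 0 <= a / (a - 1) by rewrite divr_ge0; lra.
  rewrite mulrC EFinM; apply: (@le_trans _ _ ((a / (a - 1))%:E *
    \int[mu]_(x in D) (`|g x| `^ p)%:E)%E); last by rewrite lee_wpmul2l.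
  have gp0 x : D x -> (0 <= (`|g x| `^ p)%:E)%E by rewrite lee_fin powR_ge0.
  rewrite -(ge0_integralZl_EFin _ mD gp0 mgp a0).
  apply: ge0_le_integral => //.
  + by move=> x _; apply: sume_ge0.
  + exact: emeasurable_sum.
  + exact: measurable_funeM.
  + move=> x Dx; under eq_bigr do rewrite -EFinM; rewrite sumEFin -EFinM lee_fin.
    rewrite mulrC; have -> : \sum_(0 <= j < k) c j * \1_(F j) x =
      \sum_(0 <= j < k) (if m `^ p * a ^+ j < `|g x| `^ p then m `^ p * a ^+ j else 0).
      apply: eq_bigr => j _; rewrite indicE.
      have -> : m `^ p * a ^+ j = c j.
        by rewrite /c powRM ?exprn_ge0 ?ltW// powR_exprn.
      rewrite -lt_pow//; case: (boolP (x \in F j)).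
        by rewrite inE => -[_ ->]; rewrite mulr1.
      rewrite notin_setE /F /= => h; case: ifPn; last by rewrite mulr0.
      by move=> h2; exfalso; exact: h.
    by apply: sum_geometric_below_le => //; exact: powR_ge0.
Qed.

Lemma superlevel_radii (D : set X) (g : X -> R) (p s b m I : R) :
  measurable D -> measurable_fun D g -> (forall x, D x -> 0 <= g x) ->
  0 < p -> 0 < s -> 0 < b -> 0 < m -> 0 < I ->
  (\int[mu]_(x in D) (`|g x| `^ p)%:E <= I%:E)%E ->
  exists rho : nat -> R, [/\ forall j, 0 < rho j,
    forall j, (mu (D `&` [set x | (m * 2 ^+ j < g x)%R]) < (b * rho j `^ s)%:E)%E,
    forall j, b * (m * 2 ^+ j) `^ p * rho j `^ s <= 2 * I &
    forall k, \sum_(0 <= j < k) b * (m * 2 ^+ j) `^ p * rho j `^ s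
      <= I * (2 `^ p / (2 `^ p - 1) + 2)].
Proof.
move=> mD mg g0 p0 s0 b0 m0 I0 gI.
have [w [w0 Fw wI wsum]] := superlevel_measure _ _ _ _ _ mD mg g0 p0 m0 gI.
pose c j := (m * 2 ^+ j) `^ p.
have c0 j : 0 < c j by rewrite powR_gt0// mulr_gt0// exprn_gt0.
(* The added amount makes [rho j] positive and the inequality on measures strict, even if [w j]
   vanishes; its weighted terms I / 2^j sum to at most 2 I. *)
pose w' j := w j + I / c j / 2 ^+ j.
have e0 j : 0 < I / c j / 2 ^+ j by rewrite !divr_gt0// exprn_gt0.
have w'0 j : 0 < w' j by rewrite ltr_wpDl.
pose rho j := (w' j / b) `^ s^-1.
have rhoE j : b * rho j `^ s = w' j.
  rewrite /rho -powRrM mulVf ?gt_eqF// powRr1 ?divr_ge0 ?ltW//.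
  by rewrite mulrCA mulfV ?mulr1// gt_eqF.
have cw' j : b * c j * rho j `^ s = c j * w j + I / 2 ^+ j.
  rewrite mulrAC rhoE /w' mulrDl mulrC; congr (_ + _).
  by rewrite mulrAC mulfVK// gt_eqF.
exists rho; split => [j|j|j|k].
- by rewrite powR_gt0// divr_gt0.
- by rewrite Fw rhoE lte_fin ltrDl.
- rewrite cw' -/(c j); have : I / 2 ^+ j <= I.
    by rewrite ler_pdivrMr ?exprn_gt0// ler_peMr ?(ltW I0)// exprn_ege1// ler1n.
  have := wI j; rewrite -/(c j); lra.
- under eq_bigr do rewrite cw'; rewrite big_split/= mulrDr lerD//.
  rewrite -big_distrr/= ler_wpM2l ?(ltW I0)//.
  have -> : \sum_(0 <= j < k) (2 ^+ j)^-1 = \sum_(0 <= j < k) 2^-1 ^+ j :> R.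
    by apply: eq_bigr => j _; rewrite exprVn.
  have : (1 - 2^-1) * \sum_(0 <= j < k) 2^-1 ^+ j <= 1 :> R.
    by apply: sum_geometric_le1; lra.
  lra.
Qed.

End superlevel.

(** * Chains of balls *)

Section descent.
Context {d : measure_display} {R : realType} {X : borelMetricType d R}.
Variable mu : {measure set X -> \bar R}.

Lemma measurable_borel_ball (x : X) (t : R) : measurable (ball x t).
Proof.
rewrite borel_measurableE; apply: sub_sigma_algebra => /=.
rewrite openE => y; rewrite ballEmdist /interior /= => xy.
apply/nbhs_ballP; exists (t - mdist x y); first by rewrite /= subr_gt0.
move=> w; rewrite ballEmdist /= => yw.
by rewrite (le_lt_trans (metric_triangle x y w))// -ltrBrDl.
Qed.

(** Induction on the number of steps. With K the last index, the ball of radius [rho K] around x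
    lies in A by the distance condition and has more measure than {g > m 2^K} in A. So it contains a
    point y outside N with g y <= m 2^K, from which the chain continues. The final level [k0] is
    free because uniform continuity needs tails of the sums. *)
Lemma hajlasz_descent (z : X) (rad Ro b s m : R) (u g : X -> R) (N : set X)
    (rho : nat -> R) :
  let A := ball z rad in
  measurable_fun A g -> mu.-negligible N ->
  (forall x y, (A `\` N) x -> (A `\` N) y ->
    `|u x - u y| <= mdist x y * (g x + g y)) ->
  (forall x t, A x -> 0 < t <= Ro -> ((b * t `^ s)%:E <= mu (ball x t))%E) ->
  0 < m -> (forall j, 0 < rho j <= Ro) ->
  (forall j, (mu (A `&` [set x | (m * 2 ^+ j < g x)%R])
    < (b * rho j `^ s)%:E)%E) ->
  forall k0 i x, (A `\` N) x -> g x <= m * 2 ^+ (k0 + i) ->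
  mdist z x + \sum_(k0 <= j < k0 + i) rho j < rad ->
  exists x', [/\ (A `\` N) x', g x' <= m * 2 ^+ k0,
    mdist x x' <= \sum_(k0 <= j < k0 + i) rho j &
    `|u x - u x'| <= 3 * m * \sum_(k0 <= j < k0 + i) 2 ^+ j * rho j].
Proof.
move=> A mg [N' [mN' N'0 NN']] ugN mass m0 rho0 rhomu k0.
elim=> [|i IH] x ANx gx zx.
  exists x; rewrite addn0 in gx *; rewrite !big_geq// mdistxx subrr normr0 mulr0.
  by split.
rewrite addnS in gx zx *; set K := (k0 + i)%N in gx zx IH *.
have k0K : (k0 <= K)%N by exact: leq_addr.
rewrite big_nat_recr//= in zx; rewrite !big_nat_recr//=.
have S0 : 0 <= \sum_(k0 <= j < K) rho j.
  by apply: sumr_ge0 => j _; case/andP: (rho0 j) => /ltW.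
have ballA : ball x (rho K) `<=` A.
  move=> y; rewrite /A !ballEmdist/= => xy.
  by have := metric_triangle z x y; lra.
have [y [xy ANy gy]] : exists y, [/\ mdist x y < rho K, (A `\` N) y &
    g y <= m * 2 ^+ K].
  apply/not_existsP => noy; have := rhomu K; apply/negP; rewrite -leNgt.
  apply: le_trans (mass x (rho K) ANx.1 (rho0 K)) _.
  set F := A `&` _; have mF : measurable F.
    have -> : F = A `&` [set x | (m * 2 ^+ K)%:E < (g x)%:E]%E.
      by apply/seteqP; split => w [Aw]/=; rewrite lte_fin.
    have mA : measurable A by exact: measurable_borel_ball.
    by apply: emeasurable_fun_o_infty => //; exact/measurable_EFinP.
  rewrite -(measureU0 mF mN' N'0); apply: le_measure; rewrite ?inE//.
  - exact: measurable_borel_ball.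
  - exact: measurableU.
  move=> y xy; have [/NN'|Ny] := pselect (N y); [by right|left].
  split; first exact: ballA.
  rewrite /= ltNge; apply/negP => gy; apply: (noy y); split => //.
  - by move: xy; rewrite ballEmdist.
  - by split => //; exact: ballA.
have [] := IH y ANy gy.
  by have := metric_triangle z x y; move: zx; set S := bigop _ _ _; lra.
move=> x' [ANx' gx' yx' uyx']; exists x'; split => //.
  have := metric_triangle x y x'; move: yx'; set S := bigop _ _ _; lra.
(* Here g x <= m 2^(K+1) and g y <= m 2^K, and their sum 3 m 2^K is the source of the factor 3. *)
have uxy : `|u x - u y| <= 3 * m * (2 ^+ K * rho K).
  apply: le_trans (ugN _ _ ANx ANy) _.
  apply: (@le_trans _ _ (rho K * (m * 2 ^+ K.+1 + m * 2 ^+ K))).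
    apply: (@le_trans _ _ (mdist x y * (m * 2 ^+ K.+1 + m * 2 ^+ K))).
      by rewrite ler_wpM2l ?mdist_ge0// lerD.
    by rewrite ler_wpM2r ?(ltW xy)// addr_ge0// mulr_ge0 ?exprn_ge0// ltW.
  by rewrite exprS le_eqVlt; apply/orP; left; apply/eqP; ring.
have := ler_distD (u y) (u x) (u x'); rewrite mulrDr.
move: uyx'; set S := _ * bigop _ _ _; lra.
Qed.

End descent.

(** * Extension, oscillation and averages *)

Section extension.
Context {R : realType} {T : metricType R}.

(* The extension is the lower limit of u along D. *)
Lemma dense_extension (B D : set T) (u : T -> R) :
  D `<=` B -> (forall x e, B x -> 0 < e -> exists2 y, D y & mdist x y < e) ->
  (forall e, 0 < e -> exists2 t, 0 < t &
    forall x y, D x -> D y -> mdist x y < t -> `|u x - u y| <= e) ->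
  exists v : T -> R, (forall x, D x -> v x = u x) /\
    forall t e, (forall x y, D x -> D y -> mdist x y < t -> `|u x - u y| <= e) ->
      forall x y, B x -> B y -> mdist x y < t -> `|v x - v y| <= e.
Proof.
move=> DB denseD ucu.
pose S x := [set a | exists2 t, 0 < t & forall y, D y -> mdist x y < t -> a <= u y].
pose v x := sup (S x).
(* Near x the values of u on D differ by at most e, so [S x] contains u y - e and is bounded by u y
   + e; hence its supremum [v x] is within e of u y. *)
have near e : 0 < e -> exists2 t, 0 < t &
    forall x y, B x -> D y -> mdist x y < t -> `|u y - v x| <= e.
  move=> e0; have [t t0 ut] := ucu e e0; exists (t / 2); first by rewrite divr_gt0.
  move=> x y Bx Dy xy.
  have lb : S x (u y - e).
    exists (t / 2) => [|w Dw xw]; first by rewrite divr_gt0.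
    have /(ut _ _ Dy Dw) : mdist y w < t.
      by have := metric_triangle y x w; rewrite (metric_sym y x); lra.
    by rewrite ler_norml; lra.
  have ub : ubound (S x) (u y + e).
    move=> a [t' t'0 at'].
    have m0 : 0 < Num.min t' (t / 2) by rewrite lt_min t'0 divr_gt0.
    have [w Dw xw] := denseD x _ Bx m0.
    move: xw; rewrite lt_min => /andP[/(at' _ Dw) aw xw].
    have /(ut _ _ Dy Dw) : mdist y w < t.
      by have := metric_triangle y x w; rewrite (metric_sym y x); lra.
    by rewrite ler_norml; lra.
  have h1 : u y - e <= v x.
    by apply: sup_upper_bound => //; split; [exists (u y - e)|exists (u y + e)].
  have h2 : v x <= u y + e by apply: ge_sup => //; exists (u y - e).
  by rewrite ler_norml; lra.
exists v; split => [x Dx|t e ut x y Bx By xy].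
  apply/eqP; rewrite eq_sym -subr_eq0 -normr_eq0 eq_le normr_ge0 andbT.
  apply/ler_addgt0Pl => e e0; rewrite addr0; have [t t0 vt] := near e e0.
  by apply: vt => //; [exact: DB|rewrite mdistxx].
apply/ler_addgt0Pr => h h0; have h20 : 0 < h / 2 by rewrite divr_gt0.
have [t' t'0 vt'] := near _ h20.
(* Approximating x and y in D within (t - d(x,y))/2 keeps the distance below t, so v inherits each
   pair t, e of u without loss. *)
pose c := Num.min t' ((t - mdist x y) / 2).
have c0 : 0 < c by rewrite lt_min t'0/=; lra.
have [x' Dx' xx'] := denseD x c Bx c0; have [y' Dy' yy'] := denseD y c By c0.
move: xx' yy'; rewrite !lt_min => /andP[xx' xx't] /andP[yy' yy't].
have /(ut _ _ Dx' Dy') : mdist x' y' < t.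
  have := metric_triangle x' x y'; have := metric_triangle x y y'.
  by rewrite (metric_sym x' x); lra.
have := vt' _ _ Bx Dx' xx'; have := vt' _ _ By Dy' yy'.
rewrite !ler_norml; lra.
Qed.

End extension.

Section oscillation.
Context {d : measure_display} {R : realType} {X : borelMetricType d R}.

Lemma osc_le (A : set X) (v : X -> R) (M : R) : A !=set0 ->
  (forall x y, A x -> A y -> `|v x - v y| <= M) -> (osc A v <= M%:E)%E.
Proof.
move=> [a Aa] vM; rewrite /osc.
have i_le : (ereal_inf [set (v x)%:E | x in A] <= (v a)%:E)%E.
  by apply: ereal_inf_lbound; exists a.
have le_i x : A x -> ((v x - M)%:E <= ereal_inf [set (v x)%:E | x in A])%E.
  move=> Ax; apply: le_ereal_inf_tmp => _ [y Ay <-]; rewrite lee_fin.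
  by have := vM _ _ Ax Ay; rewrite ler_norml; lra.
have ifin : ereal_inf [set (v x)%:E | x in A] \is a fin_num.
  rewrite fin_numElt (lt_le_trans _ (le_i a Aa)) ?ltNyr//=.
  by rewrite (le_lt_trans i_le) ?ltry.
rewrite leeBlDr//; apply: ge_ereal_sup => _ [x Ax <-].
by have := le_i x Ax; rewrite EFinB leeBlDl// addeC.
Qed.

Lemma unif_continuous_onP (A : set X) (v : X -> R) :
  (forall e, 0 < e -> exists2 t, 0 < t &
    forall x y, A x -> A y -> mdist x y < t -> `|v x - v y| <= e) ->
  unif_continuous_on A v.
Proof.
move=> vuc; apply/unif_continuousP => e e0.
have e20 : 0 < e / 2 by rewrite divr_gt0.
have [t t0 vt] := vuc _ e20; exists t => // -[x y] /=.
(* In the subspace structure the balls around points outside A are singletons. *)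
rewrite ball_subspace_ball /subspace_ball; case: ifPn => [|_ ->]; last first.
  exact: ballxx.
rewrite inE => Ax [Ay]; rewrite ballEmdist /= => xy.
by rewrite -ball_normE /= (le_lt_trans (vt _ _ Ax Ay xy))//; lra.
Qed.

End oscillation.

(** * Averages over a set of finite positive measure *)

Section averages.
Context {d : measure_display} {R : realType} {X : borelMetricType d R}.
Context (mu : {measure set X -> \bar R}) (B N : set X).
Context (mB : measurable B) (muB : (0 < mu B < +oo)%E) (negN : mu.-negligible N).

Let muBfin : mu B \is a fin_num.
Proof. by case/andP: muB => B0 Boo; rewrite ge0_fin_numE. Qed.

Let fmuB : 0 < fine (mu B).
Proof. exact: fine_gt0. Qed.

Let invmuB : ((mu B)^-1 = (fine (mu B))^-1%:E)%E.
Proof. by rewrite -[in LHS](fineK muBfin) inver gt_eqF. Qed.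

Lemma ae_setD (P : X -> Prop) : (forall x, (B `\` N) x -> P x) ->
  {ae mu, forall x, B x -> P x}.
Proof.
move=> BNP; apply: negligibleS negN => x /= nP.
by apply: contrapT => Nx; apply: nP => Bx; exact: BNP.
Qed.

Lemma avg_le (f F : X -> R) (C : R) :
  measurable_fun B f -> measurable_fun B F -> (forall x, 0 <= f x) ->
  (forall x, B x -> 0 <= F x) -> (forall x, (B `\` N) x -> f x <= F x) ->
  (\int[mu]_(x in B) (F x)%:E <= C%:E * mu B)%E ->
  (avg mu B (fun x => (f x)%:E) <= C%:E)%E.
Proof.
move=> mf mF f0 F0 fF FC; rewrite /avg invmuB lee_pdivrMl//.
rewrite (fineK muBfin) muleC; apply: le_trans FC.
apply: ae_ge0_le_integral => //.
- by move=> x _; rewrite lee_fin.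
- exact/measurable_EFinP.
- exact/measurable_EFinP.
- by apply: ae_setD => x BNx; rewrite lee_fin fF.
Qed.

Lemma avg_powR_le (f W : X -> R) (q D C : R) :
  measurable_fun B f -> measurable_fun B W -> (forall x, B x -> 0 <= W x) ->
  0 < q -> 0 <= D -> 0 <= C ->
  (forall x, (B `\` N) x -> `|f x| `^ q <= D `^ q * W x) ->
  (\int[mu]_(x in B) (W x)%:E <= C%:E * mu B)%E ->
  (avg mu B (fun x => (`|f x| `^ q)%:E) `^ q^-1 <= (D * C `^ q^-1)%:E)%E.
Proof.
move=> mf mW W0 q0 D0 C0 fW WC.
have avg_leC : (avg mu B (fun x => (`|f x| `^ q)%:E) <= (D `^ q * C)%:E)%E.
  apply: (@avg_le _ (fun x => D `^ q * W x)) => //.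
  - apply: (measurableT_comp (measurable_powR q)).
    exact: measurableT_comp.
  - exact: measurable_funM.
  - by move=> x Bx; rewrite mulr_ge0 ?powR_ge0 ?W0.
  under eq_integral do rewrite EFinM.
  rewrite ge0_integralZl_EFin ?powR_ge0//; last exact/measurable_EFinP.
    by rewrite EFinM -muleA lee_wpmul2l// lee_fin powR_ge0.
have avg0 : (0 <= avg mu B (fun x => (`|f x| `^ q)%:E))%E.
  rewrite /avg mule_ge0//; first by rewrite invmuB lee_fin invr_ge0 ltW.
  by apply: integral_ge0 => x _; rewrite lee_fin powR_ge0.
have q10 : 0 <= q^-1 by rewrite invr_ge0 ltW.
have -> : (D * C `^ q^-1)%:E = ((D `^ q * C)%:E `^ q^-1)%E.
  rewrite poweR_EFin powRM ?powR_ge0// -powRrM mulfV ?gt_eqF// powRr1//.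
apply: gt0_ler_poweR => //; rewrite in_itv/= leey andbT//.
by rewrite lee_fin mulr_ge0 ?powR_ge0.
Qed.

(** Domination by D F makes u - c integrable on B, so the difference of the mean and c is the
    average of u - c. This gives [mean] its meaning also for exponents p < 1. *)
Lemma mean_dist (u F : X -> R) (c D C : R) :
  measurable_fun B u -> measurable_fun B F -> (forall x, B x -> 0 <= F x) ->
  0 <= D -> 0 <= C -> (forall x, (B `\` N) x -> `|u x - c| <= D * F x) ->
  (\int[mu]_(x in B) (F x)%:E <= C%:E * mu B)%E ->
  `|mean mu B u - c| <= D * C.
Proof.
move=> mu_ mF F0 D0 C0 uF FC.
have mh : measurable_fun B (fun x => u x - c) by exact: measurable_funB.
have intnh : (\int[mu]_(x in B) `|(u x - c)%:E| <= (D * C * fine (mu B))%:E)%E.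
  apply: (@le_trans _ _ (\int[mu]_(x in B) (D%:E * (F x)%:E))%E).
    apply: ae_ge0_le_integral => //.
    - by apply/measurable_EFinP; exact: measurableT_comp.
    - by move=> x Bx; rewrite mule_ge0// lee_fin F0.
    - by apply: measurable_funeM; exact/measurable_EFinP.
    - by apply: ae_setD => x BNx; rewrite -EFinM lee_fin uF.
  rewrite ge0_integralZl_EFin//; last exact/measurable_EFinP.
  by rewrite -mulrA EFinM lee_wpmul2l// EFinM fineK.
have ih : mu.-integrable B (fun x => (u x - c)%:E).
  apply/integrableP; split; first exact/measurable_EFinP.
  by rewrite (le_lt_trans intnh)// ltry.
have ic : mu.-integrable B (cst c%:E).
  apply/integrableP; split => //; rewrite /= integral_cst//.
  by rewrite -(fineK muBfin) -EFinM ltry.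
have -> : mean mu B u - c = fine (\int[mu]_(x in B) (u x - c)%:E) / fine (mu B).
  rewrite /mean /avg.
  have -> : (\int[mu]_(x in B) (EFin \o u) x =
      \int[mu]_(x in B) (u x - c)%:E + c%:E * mu B)%E.
    rewrite -integral_cst// -integralD//.
    by apply: eq_integral => x _; rewrite -EFinD subrK.
  have hfin := integrable_fin_num mB ih.
  by rewrite -(fineK hfin) invmuB -(fineK muBfin) -!EFinM/=; field; rewrite gt_eqF.
rewrite normrM (@gtr0_norm _ (_^-1)) ?invr_gt0// ler_pdivrMr//.
have hfin := integrable_fin_num mB ih.
rewrite -lee_fin; apply: le_trans intnh.
rewrite -abse_EFin fineK//.
by apply: le_abse_integral => //; exact/measurable_EFinP.
Qed.

End averages.

(** * Estimates on a ball *)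

Section hajlasz_balls.
Context {d : measure_display} {R : realType} {X : borelMetricType d R}.
Context (mu : {measure set X -> \bar R}) (z : X) (r sigma s b Ro p G : R).
Context (u g : X -> R) (N : set X).
Let B := ball z r.
Let sB := ball z (sigma * r).
Let L := Num.min Ro ((sigma - 1) * r).
Context (sigma12 : 1 < sigma <= 2) (r0 : 0 < r) (s0 : 0 < s) (b0 : 0 < b)
  (Ro0 : 0 < Ro) (p0 : 0 < p) (G0 : 0 < G).
Context (mass : forall x t, sB x -> 0 < t <= Ro ->
  ((b * t `^ s)%:E <= mu (ball x t))%E).
Context (mg : measurable_fun sB g) (g0 : forall x, sB x -> 0 <= g x)
  (negN : mu.-negligible N).
Context (ugN : forall x y, (sB `\` N) x -> (sB `\` N) y ->
  `|u x - u y| <= mdist x y * (g x + g y)).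
Context (mfin : forall x t, 0 < t -> (0 < mu (ball x t) < +oo)%E).
Context (mesu : measurable_fun sB u).
Context (gG : (\int[mu]_(x in sB) (`|g x| `^ p)%:E <= (G `^ p)%:E)%E).

Lemma L_gt0 : 0 < L.
Proof. by rewrite lt_min Ro0/= mulr_gt0// subr_gt0; case/andP: sigma12. Qed.

Lemma L_le_r : L <= r.
Proof.
rewrite ge_min; apply/orP; right; rewrite ler_piMl ?(ltW r0)//.
by case/andP: sigma12; lra.
Qed.

(** By [level_powR] the radii decay geometrically with sum at most l. As l <= L, they are at most
    [Ro], where the lower bound on the measure applies, and chains from B stay in sigma B. The scale
    l is free so that it can be the distance of two points in the Hoelder estimate. *)
Lemma hajlasz_chain l : 0 < l <= L -> let m := level s p b l G in
  exists rho : nat -> R, [/\ forall j, 0 < rho j,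
    profile s p (fun j => rho j / l),
    (forall k0 k, \sum_(k0 <= j < k) rho j <= l) &
    forall k0 k x, (k0 <= k)%N -> (B `\` N) x -> g x <= m * 2 ^+ k ->
    exists x', [/\ (sB `\` N) x', g x' <= m * 2 ^+ k0,
      mdist x x' <= \sum_(k0 <= j < k) rho j &
      `|u x - u x'| <= 3 * m * \sum_(k0 <= j < k) 2 ^+ j * rho j]].
Proof.
move=> /andP[l0 lL] m; have m0 : 0 < m by exact: level_gt0.
have mE := level_powR s p b l G s0 p0 b0 l0 G0; rewrite -/m in mE.
have T0 := decay_gt0 s p; have T1 := decay_lt1 s p s0 p0.
have msB : measurable sB by exact: measurable_borel_ball.
have [rho [rho0 rhomu rhoI rhosum]] :=
  superlevel_radii mu _ _ _ _ _ _ _ msB mg g0 p0 s0 b0 m0 (powR_gt0 p G0) gG.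
have j0 j : 0 < (2 ^+ j) `^ p :> R by rewrite powR_gt0// exprn_gt0.
have mp0 : 0 < m `^ p by exact: powR_gt0.
have mj j : (m * 2 ^+ j) `^ p = m `^ p * (2 ^+ j) `^ p.
  by rewrite powRM// ?exprn_ge0// ltW.
have rhoT j : rho j <= (1 - decay s p) * l * decay s p ^+ j.
  have c0 : 0 <= (1 - decay s p) * l * decay s p ^+ j.
    by rewrite !mulr_ge0 ?exprn_ge0// ltW// subr_gt0.
  rewrite leNgt; apply/negP => lt.
  have : ((1 - decay s p) * l * decay s p ^+ j) `^ s < rho j `^ s.
    by rewrite gt0_ltr_powR// nnegrE// ltW.
  apply/negP; rewrite -leNgt.
  have h0 : 0 <= (1 - decay s p) * l.
    by rewrite mulr_ge0 ?subr_ge0 ?(ltW T1) ?(ltW l0).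
  rewrite (powRM _ h0 (exprn_ge0 _ (ltW T0))).
  rewrite powR_exprn ?(ltW T0)// decay_powR// powRN exprVn -powR_exprn//.
  rewrite ler_pdivlMr// -(@ler_pM2l _ (b * m `^ p)) ?mulr_gt0// mE.
  by apply: le_trans (rhoI j); rewrite mj le_eqVlt; apply/orP; left; apply/eqP; ring.
have rhol k : \sum_(0 <= j < k) rho j <= l.
  apply: (@le_trans _ _ (\sum_(0 <= j < k) (1 - decay s p) * l * decay s p ^+ j)).
    exact: ler_sum.
  rewrite -big_distrr/= mulrAC -[leRHS]mul1r ler_wpM2r ?(ltW l0)//.
  by apply: sum_geometric_le1; rewrite T1 ltW.
have {}rhol k0 k : \sum_(k0 <= j < k) rho j <= l.
  have [k0k|kk0] := leqP k0 k; last by rewrite big_geq ?ltW// ltnW.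
  apply: le_trans (rhol k); rewrite [leRHS](@big_cat_nat _ _ _ k0)//= lerDr.
  by apply: sumr_ge0 => j _; exact: ltW.
exists rho; split => // [|k0 k x k0k BNx gx].
  split => [j|j|k]; first by rewrite divr_ge0 ?ltW.
    by rewrite ler_pdivrMr//; apply: le_trans (rhoT j) _; rewrite mulrAC.
  rewrite -(@ler_pM2l _ (b * m `^ p * l `^ s)) ?mulr_gt0 ?powR_gt0//.
  rewrite big_distrr/=; apply: (@le_trans _ _
    (\sum_(0 <= j < k) b * (m * 2 ^+ j) `^ p * rho j `^ s)).
    apply: ler_sum => j _; rewrite (powR_div _ _ _ (ltW (rho0 j)) (ltW l0)) mj.
    have := powR_gt0 s l0; set x := l `^ s => x0.
    by rewrite le_eqVlt; apply/orP; left; apply/eqP; field; rewrite gt_eqF.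
  apply: le_trans (rhosum k) _; rewrite -/(radii_cst p).
  rewrite ler_wpM2r ?(ltW (radii_cst_gt0 _ _))//.
  (* [level_powR] also bounds G^p by b m^p l^s, since 1 - decay is at most 1. *)
  apply: (@le_trans _ _ (2 * G `^ p)); first by have := powR_ge0 G p; lra.
  rewrite -mE ler_wpM2l ?mulr_ge0 ?powR_ge0 ?(ltW b0)//.
  apply: ler_powRl; first exact: ltW.
    by rewrite mulr_ge0 ?subr_ge0 ?(ltW T1) ?(ltW l0).
  by rewrite ler_piMl ?(ltW l0)//; lra.
have LR : l <= Ro by apply: le_trans lL _; rewrite ge_min lexx.
have Lr : l <= (sigma - 1) * r by apply: le_trans lL _; rewrite ge_min lexx orbT.
have rhoRo j : 0 < rho j <= Ro.
  rewrite rho0/= (le_trans _ LR)// (le_trans _ (rhol j j.+1))//.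
  by rewrite big_nat1.
move: gx; rewrite -(subnKC k0k) => gx.
have [Bx Nx] := BNx.
have zx : mdist z x < r by move: Bx; rewrite /B ballEmdist.
apply: (hajlasz_descent mu z (sigma * r) Ro b s) => //.
  split => //; rewrite /sB ballEmdist/=; apply: lt_le_trans zx _.
  by rewrite ler_peMl ?(ltW r0)//; case/andP: sigma12 => /ltW.
have := rhol k0 (k0 + (k - k0))%N; set S := bigop _ _ _.
by move: Lr; rewrite mulrBl mul1r; lra.
Qed.

Let m := level s p b L G.
Let weight x := 1 + 2 * g x / m.

Let L0 : 0 < L := L_gt0.
Let m0 : 0 < m := level_gt0 _ _ _ _ _ s0 p0 b0 L0 G0.

Lemma subset_ball : B `<=` sB.
Proof.
move=> x; rewrite /B /sB !ballEmdist/= => zx; apply: (lt_le_trans zx).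
by rewrite ler_peMl ?(ltW r0)//; case/andP: sigma12 => /ltW.
Qed.

Lemma mass_le : b * L `^ s <= fine (mu B).
Proof.
have /andP[_ fB] := mfin z r r0.
rewrite -lee_fin fineK ?ge0_fin_numE//.
apply: (@le_trans _ _ (mu (ball z L))).
  apply: mass; last by rewrite L0 ge_min lexx.
  rewrite /sB ballEmdist/= mdistxx mulr_gt0//.
  by case/andP: sigma12 => s1 _; apply: lt_trans s1.
apply: le_measure; rewrite ?inE; [exact: measurable_borel_ball..|].
by apply: le_ball; exact: L_le_r.
Qed.

Lemma weight_ge1 x : B x -> 1 <= weight x.
Proof.
move=> Bx; rewrite lerDl divr_ge0 ?(ltW m0)// mulr_ge0// g0//.
exact: subset_ball.
Qed.

Lemma measurable_weight q : measurable_fun B (fun x => weight x `^ q).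
Proof.
apply: (measurableT_comp (measurable_powR q)).
apply: measurable_funD => //; apply: measurable_funM => //.
apply: measurable_funM => //.
by apply: (measurable_funS _ subset_ball mg); exact: measurable_borel_ball.
Qed.

(** By (1 + t)^p <= 2^p (1 + t^p) it is enough to bound the integral of (2 g / m)^p, which is at
    most 2^p G^p / m^p <= 2^p b L^s <= 2^p mu(B) by [level_powR] and [mass_le]. *)
Lemma integral_weight :
  (\int[mu]_(x in B) (weight x `^ p)%:E <= (weight_cst p)%:E * mu B)%E.
Proof.
have mB : measurable B by exact: measurable_borel_ball.
have msB : measurable sB by exact: measurable_borel_ball.
have fB : mu B \is a fin_num.
  by have /andP[_ fB] := mfin z r r0; rewrite ge0_fin_numE.
have mgp : measurable_fun sB (fun x => (`|g x| `^ p)%:E).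
  apply/measurable_EFinP; apply: (measurableT_comp (measurable_powR p)).
  exact: measurableT_comp.
have mgpB := measurable_funS msB subset_ball mgp.
pose c := (2 / m) `^ p.
have c0 : 0 <= c by exact: powR_ge0.
apply: (@le_trans _ _
  (\int[mu]_(x in B) ((2 `^ p)%:E * (1%:E + c%:E * (`|g x| `^ p)%:E)))%E).
  apply: ge0_le_integral => //.
  - by move=> x _; rewrite lee_fin powR_ge0.
  - by apply/measurable_EFinP; exact: measurable_weight.
  - apply: measurable_funeM; apply: emeasurable_funD => //.
    exact: measurable_funeM.
  - move=> x Bx; rewrite -(EFinM c) -EFinD -EFinM lee_fin.
    have gx0 : 0 <= g x by exact/g0/subset_ball.
    have -> : weight x = 1 + 2 / m * `|g x| by rewrite /weight ger0_norm// mulrAC.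
    rewrite -powRM ?divr_ge0 ?(ltW m0)//.
    have := @powR_addl_le _ p 1 (2 / m * `|g x|).
    by rewrite powR1; apply; rewrite ?(ltW p0)// mulr_ge0 ?divr_ge0 ?(ltW m0).
rewrite ge0_integralZl_EFin ?powR_ge0//; first last.
- by apply: emeasurable_funD => //; exact: measurable_funeM.
- by move=> x _; rewrite adde_ge0// mule_ge0// lee_fin powR_ge0.
rewrite /weight_cst EFinM -muleA lee_wpmul2l ?lee_fin ?powR_ge0//.
rewrite ge0_integralD//; first last.
- exact: measurable_funeM.
- by move=> x _; rewrite mule_ge0// lee_fin powR_ge0.
rewrite integral_cst// mul1e EFinD ge0_muleDl// ?lee_fin ?powR_ge0// mul1e.
rewrite leeD2l// ge0_integralZl_EFin//.
have gB : (\int[mu]_(x in B) (`|g x| `^ p)%:E <= (G `^ p)%:E)%E.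
  apply: le_trans gG; apply: ge0_subset_integral => //; last exact: subset_ball.
apply: (@le_trans _ _ (c%:E * (G `^ p)%:E)%E); first by rewrite lee_wpmul2l.
rewrite -(fineK fB) -!EFinM lee_fin /c powR_div ?(ltW m0)// -mulrA.
rewrite ler_wpM2l ?powR_ge0//; apply: le_trans mass_le.
have mE := level_powR s p b L G s0 p0 b0 L0 G0; rewrite -/m in mE.
rewrite mulrC ler_pdivrMr ?powR_gt0//.
have T0 := decay_gt0 s p; have T1 := decay_lt1 s p s0 p0.
apply: (@le_trans _ _ (2 * G `^ p)); first by have := powR_ge0 G p; lra.
rewrite -mE mulrAC ler_wpM2r ?powR_ge0// ler_wpM2l ?(ltW b0)//.
apply: ler_powRl; first exact: ltW.
  by rewrite mulr_ge0 ?subr_ge0 ?(ltW T1) ?(ltW L0).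
by rewrite ler_piMl ?(ltW L0)//; lra.
Qed.

(** Balls have positive measure, so the null set N contains none. *)
Lemma dense_setD x e : B x -> 0 < e -> exists2 y, (B `\` N) y & mdist x y < e.
Proof.
move=> Bx e0; have zx : mdist z x < r by move: Bx; rewrite /B ballEmdist.
pose t := Num.min e (r - mdist z x).
have t0 : 0 < t by rewrite lt_min e0/= subr_gt0.
apply: contrapT => no; have /andP[+ _] := mfin x t t0.
suff -> : mu (ball x t) = 0 by rewrite ltxx.
apply: measure_negligible; first exact: measurable_borel_ball.
apply: negligibleS negN => y; rewrite ballEmdist/= lt_min => /andP[xe xr].
apply: contrapT => Ny; apply: no; exists y => //; split => //.
by rewrite /B ballEmdist/=; have := metric_triangle z x y; lra.
Qed.

(** For the least k, either k = 0, covered by the summand 1 of [weight], or m 2^(k-1) < g x, that is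
    2^k < 2 g x / m. *)
Lemma minimal_level_exponent x : B x ->
  exists k, g x <= m * 2 ^+ k /\ 2 ^+ k <= weight x.
Proof.
move=> Bx; have [k gk kmin] := ex_minnP (le_mul_pow2 (g x) m m0).
exists k; split => //; case: k gk kmin => [|k] gk kmin.
  by rewrite expr0 weight_ge1.
have lt : m * 2 ^+ k < g x.
  by rewrite ltNge; apply/negP => /kmin; rewrite ltnn.
have : 2 ^+ k.+1 <= 2 * g x / m.
  by rewrite ler_pdivlMr// exprS -mulrA [_ * m]mulrC ler_wpM2l// ltW.
by rewrite /weight; lra.
Qed.

(** Both points descend to {g <= m 2^k0}, where u is 2 m 2^k0-Lipschitz. Since 2^k0 <= 2^j along the
    chains, 2^k0 times the length of a chain is at most tau. The chains contribute 2 * 3 m tau, and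
    the added distance of their ends 2 * 2 m tau: together 10 m tau. *)
Lemma hajlasz_two_point l rho k0 tau :
  let m := level s p b l G in
  0 < m -> (forall j, 0 < rho j) ->
  (forall k x, (k0 <= k)%N -> (B `\` N) x -> g x <= m * 2 ^+ k ->
    exists x', [/\ (sB `\` N) x', g x' <= m * 2 ^+ k0,
      mdist x x' <= \sum_(k0 <= j < k) rho j &
      `|u x - u x'| <= 3 * m * \sum_(k0 <= j < k) 2 ^+ j * rho j]) ->
  (forall k, \sum_(k0 <= j < k) 2 ^+ j * rho j <= tau) ->
  forall x y, (B `\` N) x -> (B `\` N) y ->
  `|u x - u y| <= 10 * m * tau + 2 * m * 2 ^+ k0 * mdist x y.
Proof.
move=> m' m'0 rho0 chain tail x y BNx BNy.
have down w : (B `\` N) w -> exists w', [/\ (sB `\` N) w', g w' <= m' * 2 ^+ k0,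
    2 ^+ k0 * mdist w w' <= tau & `|u w - u w'| <= 3 * m' * tau].
  move=> BNw.
  have [k k0k gk] : exists2 k, (k0 <= k)%N & g w <= m' * 2 ^+ k.
    have [k1 gk1] := le_mul_pow2 (g w) m' m'0.
    exists (maxn k0 k1); first exact: leq_maxl.
    apply: (le_trans gk1); rewrite ler_wpM2l ?(ltW m'0)//.
    by rewrite ler_weXn2l ?ler1n// leq_maxr.
  have [w' [Nw' gw' dw' uw']] := chain k w k0k BNw gk.
  exists w'; split => //; last first.
    by apply: (le_trans uw'); rewrite ler_wpM2l ?tail// mulr_ge0// ltW.
  apply: le_trans (tail k); apply: (@le_trans _ _ (2 ^+ k0 * \sum_(k0 <= j < k) rho j)).
    by rewrite ler_wpM2l ?exprn_ge0.
  rewrite big_distrr/=; apply: ler_sum_nat => j /andP[k0j _].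
  by rewrite ler_wpM2r ?(ltW (rho0 j))// ler_eXn2l// ltr1n.
have [x' [Nx' gx' dx' ux']] := down x BNx; have [y' [Ny' gy' dy' uy']] := down y BNy.
have h2 : 0 < 2 ^+ k0 :> R by exact: exprn_gt0.
have uxy' : `|u x' - u y'| <= 2 * m' * (2 ^+ k0 * mdist x' y').
  apply: (le_trans (ugN _ _ Nx' Ny')).
  apply: (@le_trans _ _ (mdist x' y' * (m' * 2 ^+ k0 + m' * 2 ^+ k0))).
    by rewrite ler_wpM2l ?mdist_ge0// lerD.
  by rewrite le_eqVlt; apply/orP; left; apply/eqP; ring.
have dxy' : 2 ^+ k0 * mdist x' y' <= 2 * tau + 2 ^+ k0 * mdist x y.
  have : mdist x' y' <= mdist x x' + mdist y y' + mdist x y.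
    have := metric_triangle x' x y'; have := metric_triangle x y y'.
    by rewrite (metric_sym x' x); lra.
  by rewrite -(ler_pM2l h2) !mulrDr; lra.
have {}uxy' : `|u x' - u y'| <= 2 * m' * (2 * tau + 2 ^+ k0 * mdist x y).
  by apply: (le_trans uxy'); rewrite ler_wpM2l// mulr_ge0// ltW.
have := ler_distD (u x') (u x) (u y); have := ler_distD (u y') (u x') (u y).
rewrite (distrC (u y') (u y)); lra.
Qed.

(** c is the value of u at the end of one fixed chain. Every chain ends in sigma B with g <= m; as
    sigma <= 2, two ends are at most 4 r apart, and u differs there by at most 4 r * 2 m. *)
Lemma hajlasz_pointwise : exists (y : nat -> R) (c : R), profile s p y /\
  (forall x, (B `\` N) x -> exists2 k, 2 ^+ k <= weight x &
    `|u x - c| <= 8 * m * r + 3 * m * L * \sum_(0 <= j < k) 2 ^+ j * y j).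
Proof.
have LL : 0 < L <= L by rewrite L0 lexx.
have [rho [rho0 rhoP _ chain]] := hajlasz_chain L LL.
have [w BNw _] := dense_setD z r (ballxx _ r0) r0.
have [kw gw] := le_mul_pow2 (g w) m m0.
have [w' [Nw' gw' _ _]] := chain 0%N kw w (leq0n _) BNw gw.
exists (fun j => rho j / L), (u w'); split => // x BNx.
have [k [gk kH]] := minimal_level_exponent x BNx.1.
exists k => //.
have [x' [Nx' gx' _ ux']] := chain 0%N k x (leq0n _) BNx gk.
have -> : 3 * m * L * (\sum_(0 <= j < k) 2 ^+ j * (rho j / L)) =
    3 * m * \sum_(0 <= j < k) 2 ^+ j * rho j.
  rewrite -mulrA big_distrr/=; congr (_ * _); apply: eq_bigr => j _.
  by field; rewrite gt_eqF.
have ux'w' : `|u x' - u w'| <= 8 * m * r.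
  apply: (le_trans (ugN _ _ Nx' Nw')); rewrite expr0 mulr1 in gx' gw'.
  apply: (@le_trans _ _ (4 * r * (m + m))); last first.
    by rewrite le_eqVlt; apply/orP; left; apply/eqP; ring.
  have dx' : mdist x' w' <= 4 * r.
    have := Nx'.1; have := Nw'.1; rewrite /sB !ballEmdist/=.
    have := metric_triangle x' z w'; rewrite (metric_sym x' z).
    have : sigma * r <= 2 * r by rewrite ler_wpM2r ?(ltW r0)//; case/andP: sigma12.
    lra.
  apply: ler_pM => //; [exact: mdist_ge0| |exact: lerD].
  by rewrite addr_ge0// g0//; [have [] := Nx'|have [] := Nw'].
rewrite -/m in ux'.
have := ler_distD (u x') (u x) (u w'); lra.
Qed.

(** * Integral estimates and moduli of continuity *)

Let CH : R := weight_cst p.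

Let CH_ge1 : 1 <= CH.
Proof.
have : 1 <= 2 `^ p :> R by rewrite ltW// powR_gt1// ltr1n.
rewrite /CH /weight_cst; set a := 2 `^ p => a1; rewrite -[leLHS]mulr1 ler_pM//; lra.
Qed.

Let CH_ge0 : 0 <= CH. Proof. exact: le_trans CH_ge1. Qed.

Let mL_ge0 : 0 <= m * L. Proof. exact: mulr_ge0 (ltW m0) (ltW L0). Qed.

Let mr_ge0 : 0 <= m * r. Proof. exact: mulr_ge0 (ltW m0) (ltW r0). Qed.

Let mB : measurable B. Proof. exact: measurable_borel_ball. Qed.

Let mesuB : measurable_fun B u.
Proof.
by apply: (measurable_funS _ subset_ball mesu); exact: measurable_borel_ball.
Qed.

Let mesW q : measurable_fun B (fun x => weight x `^ q).
Proof. exact: measurable_weight. Qed.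

Let muB : (0 < mu B < +oo)%E. Proof. exact: mfin. Qed.

(** 2^k <= weight gives |u - c| <= D weight^(1 - p/s), and (1 - p/s) ps = p turns the ps-th power
    into weight^p, integrated in [integral_weight]. The parameter kappa takes one value for the
    basic estimates and another for the sharp one. *)
Lemma hajlasz_subcritical kappa :
  let ps := s * p / (s - p) in let D := m * (8 * r + 3 * L * kappa) in
  p < s -> 0 <= kappa ->
  (forall y k, profile s p y ->
    \sum_(0 <= j < k) 2 ^+ j * y j <= kappa * (2 ^+ k) `^ (1 - p / s)) ->
  (exists c, (avg mu B (fun x => (`|u x - c| `^ ps)%:E) `^ ps^-1
    <= (D * CH `^ ps^-1)%:E)%E) /\
  (1 <= ps -> (avg mu B (fun x => (`|u x - mean mu B u| `^ ps)%:E) `^ ps^-1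
    <= (D * (1 + CH) * CH `^ ps^-1)%:E)%E).
Proof.
move=> ps D plts kappa0 hk; have sp0 : 0 < s - p by rewrite subr_gt0.
have ps0 : 0 < ps by rewrite divr_gt0// mulr_gt0.
pose a := 1 - p / s; have a0 : 0 < a by rewrite subr_gt0 ltr_pdivrMr// mul1r.
have aps : a * ps = p by rewrite /a /ps; field; rewrite !gt_eqF.
have D0 : 0 <= D.
  by rewrite mulr_ge0 ?(ltW m0)// addr_ge0// !mulr_ge0// ?(ltW r0) ?(ltW L0).
have [y [c [yP uc]]] := hajlasz_pointwise.
have pt x : (B `\` N) x -> `|u x - c| <= D * weight x `^ a.
  move=> BNx; have [k kH ux] := uc x BNx; apply: (le_trans ux).
  have H1 := weight_ge1 x BNx.1; have Ha1 : 1 <= weight x `^ a.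
    by rewrite -[leLHS](powRr0 (weight x)) ler_powR// ltW.
  have Sk : \sum_(0 <= j < k) 2 ^+ j * y j <= kappa * weight x `^ a.
    apply: (le_trans (hk y k yP)); rewrite ler_wpM2l//.
    by apply: ler_powRl; rewrite ?exprn_ge0// ltW.
  have -> : D * weight x `^ a =
      8 * m * r * weight x `^ a + 3 * m * L * (kappa * weight x `^ a).
    by rewrite /D; ring.
  apply: lerD; last by rewrite ler_wpM2l// -mulrA mulr_ge0.
  by rewrite ler_peMr// -mulrA mulr_ge0.
have HW c' D' x : 0 <= D' -> (B `\` N) x -> `|u x - c'| <= D' * weight x `^ a ->
    `|u x - c'| `^ ps <= D' `^ ps * weight x `^ p.
  move=> D'0 BNx h; have -> : weight x `^ p = (weight x `^ a) `^ ps.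
    by rewrite -powRrM aps.
  rewrite -powRM ?powR_ge0//.
  by apply: ler_powRl => //; exact: ltW.
have intW := integral_weight; rewrite -/CH in intW.
have final c' D' : 0 <= D' ->
    (forall x, (B `\` N) x -> `|u x - c'| <= D' * weight x `^ a) ->
    (avg mu B (fun x => (`|u x - c'| `^ ps)%:E) `^ ps^-1
    <= (D' * CH `^ ps^-1)%:E)%E.
  move=> D'0 h.
  apply: (avg_powR_le mu B N mB muB negN _ (fun x => weight x `^ p)) => //.
  - exact: measurable_funB.
  - by move=> x _; exact: powR_ge0.
  - by move=> x BNx; apply: HW => //; exact: h.
split; first by exists c; exact: final.
(* ps >= 1 means 1 - p/s <= p, so weight^(1 - p/s) <= weight^p has a bounded average and the mean of
   u lies within D * CH of c. *)
move=> ps1; have ap : a <= p by rewrite -aps ler_peMr// ltW.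
have mean_c : `|mean mu B u - c| <= D * CH.
  apply: (mean_dist mu B N mB muB negN _ (fun x => weight x `^ p)) => //.
  - by move=> x _; exact: powR_ge0.
  - move=> x BNx; apply: (le_trans (pt x BNx)); rewrite ler_wpM2l//.
    by rewrite ler_powR// weight_ge1//; exact: BNx.1.
apply: final; first by rewrite mulr_ge0// addr_ge0.
move=> x BNx; have Ha1 : 1 <= weight x `^ a.
  rewrite -[leLHS](powRr0 (weight x)) ler_powR ?(ltW a0)// weight_ge1//.
  exact: BNx.1.
have := ler_distD c (u x) (mean mu B u); rewrite (distrC c); move=> h.
apply: (le_trans h); have -> : D * (1 + CH) * weight x `^ a =
  D * weight x `^ a + D * CH * weight x `^ a by ring.
apply: lerD; first exact: pt.
by apply: (le_trans mean_c); rewrite ler_peMr// mulr_ge0.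
Qed.

(** |u - mean| is at most 20 m r (1 + CH) (k + 1)^(1/q) at a point with exponent k. The choice of c
    bounds the exponential there by 2^(k+1) <= 2 weight <= 2 weight^s, which [integral_weight]
    averages. *)
Lemma hajlasz_exponential c : p = s -> 1 < s ->
  let q := s / (s - 1) in
  0 < c -> c * (20 * level_cst s s * (1 + CH)) `^ q <= ln 2 ->
  (avg mu B (fun x =>
     (expR (c * (L / r * (b `^ s^-1 * `|u x - mean mu B u| / G)) `^ q))%:E)
     <= (2 * CH)%:E)%E.
Proof.
move=> ps s1 q c0 cle; have s10 : 0 < s - 1 by rewrite subr_gt0.
have q0 : 0 < q by rewrite divr_gt0.
have q1 : 1 <= q by rewrite ler_pdivlMr// mul1r gerBl.
have iq1 : q^-1 <= 1 by rewrite invf_le1.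
have iq0 : 0 < q^-1 by rewrite invr_gt0.
have [y [e [yP ue]]] := hajlasz_pointwise.
have k1W x k : (B `\` N) x -> 2 ^+ k <= weight x -> k%:R + 1 <= weight x `^ p.
  move=> BNx kH; apply: (@le_trans _ _ (weight x)).
    by apply: le_trans kH; rewrite natr1 -natrX ler_nat ltn_expl.
  by rewrite le1r_powR ?weight_ge1//; [exact: BNx.1|rewrite ps ltW].
have D0 : 0 <= 20 * m * r by rewrite -mulrA mulr_ge0.
have pt x : (B `\` N) x -> exists2 k, 2 ^+ k <= weight x &
    `|u x - e| <= 20 * m * r * (k%:R + 1) `^ q^-1.
  move=> BNx; have [k kH ux] := ue x BNx; exists k => //; apply: (le_trans ux).
  have := oscillation_sum_eq_gt1 s p y s0 p0 yP k ps s1; rewrite -/q.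
  have K1 : 1 <= (k%:R + 1) `^ q^-1 :> R.
    by rewrite -[leLHS](powRr0 (k%:R + 1)) ler_powR ?lerDr// ltW.
  set K := _ `^ _ in K1 *; set S := bigop _ _ _ => SK.
  (* 20 = 8 + 3 * 4, using 1 <= K and L <= r. *)
  have h1 : 8 * (m * r) <= 8 * (m * r) * K by rewrite ler_peMr// mulr_ge0.
  have h2 : 3 * (m * L) * S <= 3 * (m * r) * (4 * K).
    apply: ler_pM => //; [by rewrite mulr_ge0| |].
      by apply: sumr_ge0 => j _; case: yP => y0 _ _; rewrite mulr_ge0 ?exprn_ge0.
    by rewrite !ler_wpM2l// ?(ltW m0)//; exact: L_le_r.
  by rewrite -!mulrA in h1 h2 *; lra.
have intW := integral_weight; rewrite -/CH in intW.
have mean_e : `|mean mu B u - e| <= 20 * m * r * CH.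
  apply: (mean_dist mu B N mB muB negN _ (fun x => weight x `^ p)) => //.
    by move=> x _; exact: powR_ge0.
  move=> x BNx; have [k kH ux] := pt x BNx; apply: (le_trans ux).
  rewrite ler_wpM2l//; apply: le_trans (k1W x k BNx kH).
  by rewrite ler1_powR// lerDr.
apply: (avg_le mu B N mB muB negN _ (fun x => 2 * weight x `^ p)) => //.
- apply: measurableT_comp => //; apply: measurable_funM => //.
  apply: (measurableT_comp (measurable_powR q)); apply: measurable_funM => //.
  apply: measurable_funM => //; apply: measurable_funM => //.
  by apply: measurableT_comp => //; exact: measurable_funB.
- exact: measurable_funM.
- by move=> x _; rewrite mulr_ge0// powR_ge0.
- move=> x BNx; have [k kH ux] := pt x BNx.
  have uxm : `|u x - mean mu B u| <= 20 * m * r * (1 + CH) * (k%:R + 1) `^ q^-1.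
    have K1 : 1 <= (k%:R + 1) `^ q^-1 :> R.
      by rewrite -[leLHS](powRr0 (k%:R + 1)) ler_powR ?lerDr// ltW.
    have := ler_distD e (u x) (mean mu B u); rewrite (distrC e) => h.
    apply: (le_trans h); rewrite mulrDr mulr1 mulrDl; apply: lerD => //.
    by apply: (le_trans mean_e); rewrite ler_peMr// mulr_ge0.
  (* For p = s the power of L in [level_mul] is 1, so m L is [level_cst] times G b^(-1/s), and b, L,
     r and G cancel. *)
  have mE : L / r * (b `^ s^-1 * (20 * m * r * (1 + CH) * (k%:R + 1) `^ q^-1) / G)
      = 20 * level_cst s s * (1 + CH) * (k%:R + 1) `^ q^-1.
    have := level_mul s p b L G L0; rewrite -/m ps divff ?gt_eqF// subrr powRr0 mulr1.
    rewrite powRN => mL; have b1 : b `^ s^-1 != 0 by rewrite gt_eqF// powR_gt0.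
    have -> : L / r * (b `^ s^-1 * (20 * m * r * (1 + CH) * (k%:R + 1) `^ q^-1) / G)
      = m * L * (b `^ s^-1 * 20 * (1 + CH) * (k%:R + 1) `^ q^-1 / G).
      by field; rewrite !gt_eqF.
    by rewrite mL; field; rewrite b1 gt_eqF.
  have : c * (L / r * (b `^ s^-1 * `|u x - mean mu B u| / G)) `^ q
      <= ln 2 * (k%:R + 1).
    apply: (@le_trans _ _ (c * (20 * level_cst s s * (1 + CH) *
        (k%:R + 1) `^ q^-1) `^ q)).
      rewrite ler_wpM2l ?(ltW c0)// -mE; apply: ler_powRl; first exact: ltW.
        by rewrite !mulr_ge0 ?invr_ge0 ?powR_ge0 ?(ltW L0) ?(ltW r0) ?(ltW G0).
      rewrite ler_wpM2l ?mulr_ge0 ?invr_ge0 ?(ltW L0) ?(ltW r0)//.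
      by rewrite ler_wpM2r ?invr_ge0 ?(ltW G0)// ler_wpM2l ?powR_ge0.
    rewrite powRM ?powR_ge0//; last first.
      by rewrite !mulr_ge0 ?(ltW (level_cst_gt0 _ _ _ _))// addr_ge0.
    by rewrite -powRrM mulVf ?gt_eqF// powRr1// mulrA ler_wpM2r.
  move=> h; apply: (@le_trans _ _ (expR (ln 2 * (k%:R + 1)))).
    by rewrite ler_expR.
  rewrite natr1 [ln 2 * _]mulrC expRM_natl lnK ?posrE//.
  apply: (@le_trans _ _ (2 * weight x)).
    by rewrite exprS ler_wpM2l.
  by rewrite ler_wpM2l// le1r_powR ?weight_ge1//; [exact: BNx.1|rewrite ps ltW].
- under eq_integral do rewrite EFinM.
  rewrite ge0_integralZl_EFin//; last exact/measurable_EFinP.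
    by rewrite EFinM -muleA lee_wpmul2l.
  by move=> x _; rewrite lee_fin powR_ge0.
Qed.

(** Beyond a suitable k0 the tail of the sum of 2^j rho_j is at most e / (20 m). In
    [hajlasz_two_point] the chains then cost e/2, and a distance below e / (4 m 2^k0) costs the
    other e/2. *)
Lemma hajlasz_unif_continuous tau :
  (forall y k, profile s p y -> \sum_(0 <= j < k) 2 ^+ j * y j <= tau) ->
  forall e, 0 < e -> exists2 t, 0 < t & forall x y, (B `\` N) x -> (B `\` N) y ->
    mdist x y < t -> `|u x - u y| <= e.
Proof.
move=> htau e e0; have LL : 0 < L <= L by rewrite L0 lexx.
have [rho [rho0 rhoP _ chain]] := hajlasz_chain L LL.
have [k0 tail] := @bounded_sum_tail _ (fun j => 2 ^+ j * (rho j / L)) tau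
  (e / (20 * m * L)) (fun j => mulr_ge0 (exprn_ge0 _ (ler0n _ 2))
    (divr_ge0 (ltW (rho0 j)) (ltW L0))) (fun k => htau _ k rhoP)
  (divr_gt0 e0 (mulr_gt0 (mulr_gt0 (ltr0n _ 20) m0) L0)).
have {}tail k : \sum_(k0 <= j < k) 2 ^+ j * rho j <= e / (20 * m).
  have -> : \sum_(k0 <= j < k) 2 ^+ j * rho j =
      L * \sum_(k0 <= j < k) 2 ^+ j * (rho j / L).
    by rewrite big_distrr/=; apply: eq_bigr => j _; field; rewrite gt_eqF.
  have -> : e / (20 * m) = L * (e / (20 * m * L)).
    by field; rewrite !gt_eqF.
  by rewrite ler_pM2l.
have two := hajlasz_two_point L rho k0 _ m0 rho0 (chain k0) tail.
have d0 : 0 < 4 * m * 2 ^+ k0 by rewrite mulr_gt0 ?exprn_gt0// mulr_gt0.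
exists (e / (4 * m * 2 ^+ k0)); first exact: divr_gt0.
move=> x y BNx BNy; rewrite ltr_pdivlMr// => xy.
apply: (le_trans (two x y BNx BNy)); rewrite -/m.
have -> : 10 * m * (e / (20 * m)) = e / 2 by field; rewrite gt_eqF.
lra.
Qed.

Lemma hajlasz_modulus tau l :
  (forall y k, profile s p y -> \sum_(0 <= j < k) 2 ^+ j * y j <= tau) ->
  0 < l <= L -> forall x y, (B `\` N) x -> (B `\` N) y ->
  `|u x - u y| <= level s p b l G * (10 * l * tau + 2 * mdist x y).
Proof.
move=> htau lL x y BNx BNy; have /andP[l0 _] := lL.
have [rho [rho0 rhoP _ chain]] := hajlasz_chain l lL.
have m'0 := level_gt0 _ _ _ _ _ s0 p0 b0 l0 G0.
have sum_le k : \sum_(0 <= j < k) 2 ^+ j * rho j <= l * tau.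
  have -> : \sum_(0 <= j < k) 2 ^+ j * rho j =
      l * \sum_(0 <= j < k) 2 ^+ j * (rho j / l).
    by rewrite big_distrr/=; apply: eq_bigr => j _; field; rewrite gt_eqF.
  by rewrite ler_pM2l// htau.
have := hajlasz_two_point l rho 0%N _ m'0 rho0 (chain 0%N) sum_le x y BNx BNy.
rewrite expr0 mulr1; move/le_trans; apply.
by rewrite le_eqVlt; apply/orP; left; apply/eqP; ring.
Qed.

Lemma hajlasz_osc tau :
  (forall y k, profile s p y -> \sum_(0 <= j < k) 2 ^+ j * y j <= tau) ->
  0 <= tau -> forall x y, (B `\` N) x -> (B `\` N) y ->
  `|u x - u y| <= level_cst s p * (10 * tau + 4) * (r / L) * b `^ (- p^-1)
    * L `^ (1 - s / p) * G.
Proof.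
move=> htau tau0 x y BNx BNy; have LL : 0 < L <= L by rewrite L0 lexx.
have -> : level_cst s p * (10 * tau + 4) * (r / L) * b `^ (- p^-1)
    * L `^ (1 - s / p) * G = m * L * ((10 * tau + 4) * (r / L)).
  by rewrite /m level_mul//; ring.
have -> : m * L * ((10 * tau + 4) * (r / L)) = m * (10 * r * tau + 4 * r).
  by field; rewrite gt_eqF.
apply: (le_trans (hajlasz_modulus tau L htau LL x y BNx BNy)).
rewrite ler_wpM2l ?(ltW m0)//; apply: lerD.
  by rewrite ler_wpM2r// ler_wpM2l//; exact: L_le_r.
have := BNx.1; have := BNy.1; rewrite /B !ballEmdist/=.
by have := metric_triangle x z y; rewrite (metric_sym x z); lra.
Qed.

(** For d(x,y) <= L the modulus at scale l = d(x,y) applies, where level * l is a multiple of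
    d(x,y)^(1 - s/p). For larger distances [hajlasz_osc] suffices, because L^(1 - s/p) <= d(x,y)^(1
    - s/p); the factor r / L comes from this case. *)
Lemma hajlasz_hoelder tau : s < p ->
  (forall y k, profile s p y -> \sum_(0 <= j < k) 2 ^+ j * y j <= tau) ->
  0 <= tau -> forall x y, (B `\` N) x -> (B `\` N) y ->
  `|u x - u y| <= level_cst s p * (10 * tau + 4) * (r / L) * b `^ (- p^-1)
    * mdist x y `^ (1 - s / p) * G.
Proof.
move=> sp htau tau0 x y BNx BNy.
have rL : 1 <= r / L by rewrite ler_pdivlMr// mul1r; exact: L_le_r.
have rL0 : 0 <= r / L by exact: le_trans rL.
have K0 := level_cst_gt0 _ _ s0 p0.
have t0 : 0 <= 10 * tau + 4 by rewrite addr_ge0// mulr_ge0.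
have a0 : 0 <= 1 - s / p by rewrite subr_ge0 ler_pdivrMr// mul1r ltW.
have [dL|Ld] := leP (mdist x y) L; last first.
  apply: (le_trans (hajlasz_osc tau htau tau0 x y BNx BNy)).
  rewrite ler_wpM2r ?(ltW G0)// ler_wpM2l//; last first.
    by apply: ler_powRl; rewrite ?(ltW L0)// ltW.
  by rewrite !(mulr_ge0 _ (powR_ge0 _ _))// mulr_ge0// mulr_ge0// ltW.
have [xy|xy] := eqVneq x y.
  rewrite xy subrr normr0; apply: mulr_ge0; last exact: ltW.
  by rewrite !(mulr_ge0 _ (powR_ge0 _ _))// mulr_ge0// mulr_ge0// ltW.
have d0 : 0 < mdist x y by rewrite mdist_gt0.
have dL2 : 0 < mdist x y <= L by rewrite d0.
apply: (le_trans (hajlasz_modulus tau _ htau dL2 x y BNx BNy)).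
have -> : level s p b (mdist x y) G * (10 * mdist x y * tau + 2 * mdist x y) =
    level s p b (mdist x y) G * mdist x y * (10 * tau + 2) by ring.
rewrite level_mul//.
have -> : level_cst s p * (10 * tau + 4) * (r / L) * b `^ (- p^-1)
    * mdist x y `^ (1 - s / p) * G = level_cst s p * G * b `^ (- p^-1) *
    mdist x y `^ (1 - s / p) * ((10 * tau + 4) * (r / L)) by ring.
rewrite ler_wpM2l ?mulr_ge0 ?powR_ge0 ?(ltW K0) ?(ltW G0)//.
apply: (@le_trans _ _ (10 * tau + 4)); first lra.
by rewrite ler_peMr.
Qed.

(** * The estimates with explicit constants *)

Let rL : 1 <= r / L. Proof. by rewrite ler_pdivlMr// mul1r; exact: L_le_r. Qed.

Let rL0 : 0 <= r / L. Proof. exact: le_trans rL. Qed.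

Let Q : R := b `^ (- p^-1) * L `^ (1 - s / p) * G.

Let Q0 : 0 <= Q. Proof. by rewrite !mulr_ge0 ?powR_ge0// ltW. Qed.

Let K0 : 0 <= level_cst s p. Proof. exact: ltW (level_cst_gt0 _ _ s0 p0). Qed.

Let mLQ : m * L = level_cst s p * Q.
Proof. by rewrite /m level_mul// /Q; ring. Qed.

Let subcritical_bound kappa c C : 0 <= c -> 0 <= kappa ->
  level_cst s p * (8 + 3 * kappa) * c <= C ->
  m * (8 * r + 3 * L * kappa) * c <= C * (r / L) * b `^ (- p^-1) *
    L `^ (1 - s / p) * G.
Proof.
move=> c0 k0 hC.
have -> : m * (8 * r + 3 * L * kappa) * c = m * L * (8 * (r / L) + 3 * kappa) * c.
  by field; rewrite gt_eqF.
have -> : C * (r / L) * b `^ (- p^-1) * L `^ (1 - s / p) * G = C * (r / L) * Q.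
  by rewrite /Q; ring.
rewrite mLQ; apply: (@le_trans _ _ (level_cst s p * (8 + 3 * kappa) * c * (r / L) * Q)).
  have -> : level_cst s p * Q * (8 * (r / L) + 3 * kappa) * c =
    level_cst s p * c * Q * (8 * (r / L) + 3 * kappa) by ring.
  have -> : level_cst s p * (8 + 3 * kappa) * c * (r / L) * Q =
    level_cst s p * c * Q * ((8 + 3 * kappa) * (r / L)) by ring.
  rewrite ler_wpM2l//; first by rewrite mulr_ge0// mulr_ge0.
  by rewrite (mulrDl 8 (3 * kappa)) lerD2l ler_peMr// mulr_ge0.
by rewrite ler_wpM2r// ler_wpM2r.
Qed.

Let kappa_ge0 : p < s -> 0 <= (2 `^ (1 - p / s) - 1)^-1.
Proof.
move=> ps; rewrite invr_ge0 subr_ge0 ltW// powR_gt1 ?ltr1n//.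
by rewrite subr_gt0 ltr_pdivrMr// mul1r.
Qed.

Lemma inf_avg_le : p < s -> let ps := s * p / (s - p) in
  (ereal_inf [set (avg mu B (fun x => (`|u x - c| `^ ps)%:E) `^ ps^-1)%E
     | c in [set: R]]
   <= (inf_cst s p * (r / L) * b `^ (- p^-1) * L `^ (1 - s / p) * G)%:E)%E.
Proof.
move=> plts; cbv zeta; set ps := s * p / (s - p); have k0 := kappa_ge0 plts.
have [[c hc] _] := hajlasz_subcritical _ plts k0
  (fun y k yP => oscillation_sum_lt s p y s0 yP k plts).
apply: ge_ereal_inf; eexists; first by exists c.
apply: (le_trans hc); rewrite lee_fin; apply: subcritical_bound => //.
  exact: powR_ge0.
by rewrite /inf_cst; apply: le_trans (ler_norm _) _; rewrite lerDr.
Qed.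

Lemma mean_avg_le : p < s -> let ps := s * p / (s - p) in 1 <= ps ->
  (avg mu B (fun x => (`|u x - mean mu B u| `^ ps)%:E) `^ ps^-1
   <= (mean_cst s p * (r / L) * b `^ (- p^-1) * L `^ (1 - s / p) * G)%:E)%E.
Proof.
move=> plts ps ps1; have k0 := kappa_ge0 plts.
have [_ /(_ ps1) hm] := hajlasz_subcritical _ plts k0
  (fun y k yP => oscillation_sum_lt s p y s0 yP k plts).
apply: (le_trans hm); rewrite lee_fin -mulrA; apply: subcritical_bound => //.
  by rewrite mulr_ge0 ?powR_ge0// addr_ge0.
by rewrite /mean_cst mulrA; apply: le_trans (ler_norm _) _; rewrite lerDr.
Qed.

(** kappa = 8 w gives m L (8 r / L + 24 w). Each factor in p is then bounded in terms of s: the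
    level constant by [level_cst_le], [weight_cst] by monotonicity, and CH^(1/ps) by CH since CH >=
    1 and ps >= 1. *)
Lemma sharp_avg_le : 1 <= p < s -> let ps := s * p / (s - p) in
  (avg mu B (fun x => (`|u x - mean mu B u| `^ ps)%:E) `^ ps^-1
   <= (sharp_cst s * (r / L + ((s - 1) / (s - p)) `^ (s / (s - 1))^-1)
       * b `^ (- p^-1) * L `^ (1 - s / p) * G)%:E)%E.
Proof.
move=> /andP[p1 plts]; cbv zeta; set ps := s * p / (s - p).
set w := ((s - 1) / (s - p)) `^ _.
have w0 : 0 <= w by exact: powR_ge0.
have k0 : 0 <= 8 * w by rewrite mulr_ge0.
have ps1 : 1 <= ps.
  rewrite ler_pdivlMr ?subr_gt0// mul1r.
  by apply: (@le_trans _ _ s); [rewrite gerBl ltW|rewrite ler_peMr ?(ltW s0)].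
have p1s : 1 <= p < s by rewrite p1.
have [_ /(_ ps1) hm] := hajlasz_subcritical _ plts k0
  (fun y k yP => oscillation_sum_sharp s p y s0 p0 yP k p1s).
apply: (le_trans hm); rewrite lee_fin.
have -> : m * (8 * r + 3 * L * (8 * w)) * (1 + CH) * CH `^ ps^-1 =
    m * L * (8 * (r / L) + 24 * w) * ((1 + CH) * CH `^ ps^-1).
  by field; rewrite gt_eqF.
have -> : sharp_cst s * (r / L + w) * b `^ (- p^-1) * L `^ (1 - s / p) * G =
    sharp_cst s * (r / L + w) * Q by rewrite /Q; ring.
rewrite mLQ; set CHs := weight_cst s.
have a2 : 2 `^ p <= 2 `^ s :> R by rewrite ler_powR ?ler1n// ltW.
have CHle : CH <= CHs by rewrite /CH /CHs /weight_cst ler_pM ?powR_ge0 ?addr_ge0// lerD2l.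
have Kle := level_cst_le s p p1 (ltW plts).
have CHps : CH `^ ps^-1 <= CHs.
  apply: le_trans CHle; rewrite -[leRHS](powRr1 CH_ge0) ler_powR// invf_le1//.
  by rewrite divr_gt0 ?mulr_gt0// subr_gt0.
have h1 : (1 + CH) * CH `^ ps^-1 <= (1 + CHs) * CHs.
  by apply: ler_pM => //; rewrite ?addr_ge0 ?powR_ge0 ?lerD2l.
set Ks : R := 2 / (1 - 2 `^ (- s^-1)) `^ s in Kle *.
have h8 : 0 <= 8 * (r / L) + 24 * w by rewrite addr_ge0// mulr_ge0.
apply: (@le_trans _ _ (Ks * Q * (24 * (r / L + w)) * ((1 + CHs) * CHs))).
  apply: ler_pM => //.
  - exact: mulr_ge0 (mulr_ge0 K0 Q0) h8.
  - by rewrite mulr_ge0 ?powR_ge0// addr_ge0.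
  - apply: ler_pM; [exact: mulr_ge0|exact: h8| |].
    + by rewrite ler_wpM2r.
    + by rewrite (mulrDr 24) lerD2r ler_wpM2r// ler_nat.
have -> : Ks * Q * (24 * (r / L + w)) * ((1 + CHs) * CHs) =
  24 * Ks * (1 + CHs) * CHs * ((r / L + w) * Q) by ring.
rewrite -[leRHS]mulrA; apply: ler_wpM2r.
  by rewrite mulr_ge0// addr_ge0.
by rewrite /sharp_cst; apply: le_trans (ler_norm _) _; rewrite lerDr.
Qed.

Lemma exp_avg_le : p = s -> 1 < s ->
  (avg mu B (fun x => (expR (exp_rate s *
     (L / r * (b `^ s^-1 * `|u x - mean mu B u| / G)) `^ (s / (s - 1))))%:E)
   <= (exp_cst s)%:E)%E.
Proof.
move=> ps s1; rewrite /exp_cst -[in X in (_ <= X)%E]ps.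
apply: hajlasz_exponential => //.
  by rewrite divr_gt0 ?powR_gt0 ?ltr_wpDr// ln_gt0// ltr1n.
rewrite /exp_rate; set E := 1 + _; have E0 : 0 < E by rewrite ltr_wpDr.
rewrite mulrAC ler_pdivrMr ?powR_gt0// ler_wpM2l ?ln_ge0 ?ler1n//.
apply: ler_powRl.
- by rewrite divr_ge0 ?(ltW s0)// subr_ge0 ltW.
- by rewrite !mulr_ge0 ?addr_ge0 ?(ltW (level_cst_gt0 _ _ _ _)).
- by rewrite /E /CH ps; apply: le_trans (ler_norm _) _; rewrite lerDr.
Qed.

Let osc_bound C c : level_cst s p * c <= C -> forall w, 0 <= w ->
  level_cst s p * c * (r / L) * b `^ (- p^-1) * w * G <=
  C * (r / L) * b `^ (- p^-1) * w * G.
Proof.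
move=> h w w0.
by do 4 (rewrite ler_wpM2r ?powR_ge0 ?(ltW G0)//).
Qed.

Lemma critical_osc_le : p = s -> s <= 1 ->
  forall x y, (B `\` N) x -> (B `\` N) y ->
  `|u x - u y| <= critical_osc_cst s * (r / L) * b `^ (- s^-1) * G.
Proof.
move=> ps s1 x y BNx BNy.
have t0 : 0 <= radii_cst s `^ s^-1 by exact: powR_ge0.
have := hajlasz_osc _
  (fun y k yP => oscillation_sum_eq_le1 s p y s0 yP k ps s1) t0 x y BNx BNy.
move/le_trans; apply.
have := osc_bound (critical_osc_cst s) (10 * radii_cst s `^ s^-1 + 4) _ 1 ler01.
rewrite ps divff ?gt_eqF// subrr powRr0 !mulr1; apply.
by rewrite /critical_osc_cst; apply: le_trans (ler_norm _) _; rewrite lerDr.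
Qed.

Let tau_ge0 : s < p -> 0 <= (1 - 2 `^ (1 - p / s))^-1 :> R.
Proof.
move=> sp; rewrite invr_ge0 subr_ge0 ltW// -opprB powR2N_lt1//.
by rewrite subr_gt0 ltr_pdivlMr ?mul1r.
Qed.

Lemma osc_cst_le : level_cst s p * (10 * (1 - 2 `^ (1 - p / s))^-1 + 4)
  <= osc_cst s p.
Proof. by rewrite /osc_cst; apply: le_trans (ler_norm _) _; rewrite lerDr. Qed.

Lemma supercritical_osc_le : s < p ->
  forall x y, (B `\` N) x -> (B `\` N) y ->
  `|u x - u y| <= osc_cst s p * (r / L) * b `^ (- p^-1) * L `^ (1 - s / p) * G.
Proof.
move=> sp x y BNx BNy.
have := hajlasz_osc _ (fun y k yP => oscillation_sum_gt s p y s0 yP k sp)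
  (tau_ge0 sp) x y BNx BNy.
by move/le_trans; apply; apply: osc_bound; [exact: osc_cst_le|exact: powR_ge0].
Qed.

Lemma supercritical_hoelder_le : s < p ->
  forall x y, (B `\` N) x -> (B `\` N) y ->
  `|u x - u y| <=
    osc_cst s p * (r / L) * b `^ (- p^-1) * mdist x y `^ (1 - s / p) * G.
Proof.
move=> sp x y BNx BNy.
have := hajlasz_hoelder _ sp
  (fun y k yP => oscillation_sum_gt s p y s0 yP k sp) (tau_ge0 sp) x y BNx BNy.
by move/le_trans; apply; apply: osc_bound; [exact: osc_cst_le|exact: powR_ge0].
Qed.

Lemma unif_continuous_setD : s < p \/ (p = s /\ s <= 1) ->
  forall e, 0 < e -> exists2 t, 0 < t & forall x y, (B `\` N) x -> (B `\` N) y ->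
    mdist x y < t -> `|u x - u y| <= e.
Proof.
move=> [sp|[ps s1]]; apply: hajlasz_unif_continuous => y k yP.
  exact: oscillation_sum_gt yP _ _.
exact: oscillation_sum_eq_le1 yP _ _ _.
Qed.

End hajlasz_balls.

(** * The theorem *)

Section limits.
Context {R : realType}.

Lemma le_limit (x : \bar R) (C n : R) : 0 <= C ->
  (forall G, n < G -> (x <= (C * G)%:E)%E) -> (x <= (C * n)%:E)%E.
Proof.
move=> C0 h; apply/lee_addgt0Pr => e e0.
(* [C] may vanish, hence [C + 1] in the denominator. *)
have C1 : 0 < C + 1 by rewrite ltr_wpDl.
have /h/le_trans : n < n + e / (C + 1) by rewrite ltrDl divr_gt0.
apply; rewrite -EFinD lee_fin mulrDr lerD2l mulrCA ler_piMr ?(ltW e0)//.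
by rewrite ler_pdivrMr// mul1r lerDl.
Qed.

Lemma Lpnorm_integral {d : measure_display} {X : borelMetricType d R}
    (mu : {measure set X -> \bar R}) (A : set X) (p : R) (g : X -> R) :
  0 < p -> (Lpnorm mu A p g < +oo)%E ->
  exists n, [/\ 0 <= n, Lpnorm mu A p g = n%:E &
    forall G, n <= G -> (\int[mu]_(x in A) (`|g x| `^ p)%:E <= (G `^ p)%:E)%E].
Proof.
move=> p0 goo; have nE : Lpnorm mu A p g = (fine (Lpnorm mu A p g))%:E.
  by rewrite fineK// ge0_fin_numE// poweR_ge0.
exists (fine (Lpnorm mu A p g)); split => //; first exact/fine_ge0/poweR_ge0.
move=> G nG; have I0 : (0 <= \int[mu]_(x in A) (`|g x| `^ p)%:E)%E.
  by apply: integral_ge0 => x _; rewrite lee_fin powR_ge0.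
rewrite -[leLHS](poweRe1 I0) -(mulVf (lt0r_neq0 p0)) poweRrM.
rewrite -/(Lpnorm mu A p g) nE poweR_EFin lee_fin.
by apply: ler_powRl => //; [exact: ltW|exact/fine_ge0/poweR_ge0].
Qed.

End limits.

Theorem theorem1p4 (R : realType) :
  exists (Cinf Cmean Cosc Chol : R -> R -> R) (Csharp cexp Cexp Cosc1 : R -> R),
  (forall s p : R, [/\ 0 < Cinf s p, 0 < Cmean s p, 0 < Cosc s p & 0 < Chol s p]) /\
  (forall s : R, [/\ 0 < Csharp s, 0 < cexp s, 0 < Cexp s & 0 < Cosc1 s]) /\
  forall (d : measure_display) (X : borelMetricType d R)
    (mu : {measure set X -> \bar R}),
  metric_measure_space mu ->
  forall (p sigma : R) (z : X) (r s b Ro : R),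
  0 < p -> 1 < sigma <= 2 -> 0 < r -> 0 < s -> 0 < b -> 0 < Ro ->
  let B := ball z r in
  let sB := ball z (sigma * r) in
  let L := Num.min Ro ((sigma - 1) * r) in
  (forall (x : X) (t : R), sB x -> 0 < t <= Ro ->
     ((b * t `^ s)%:E <= mu (ball x t))%E) ->
  forall u g : X -> R,
  M1p mu sB p u -> hajlasz_gradient mu sB u g -> Lp mu sB p g ->
  [/\ (p < s ->
        let ps := s * p / (s - p) in
        [/\ (ereal_inf [set (avg mu B (fun x => (`|u x - gamma| `^ ps)%:E)
                               `^ ps^-1)%E | gamma in [set: R]]
               <= (Cinf s p * (r / L) * b `^ (- p^-1) * L `^ (1 - s / p))%:E
                    * Lpnorm mu sB p g)%E,
            (1 <= ps ->
              (avg mu B (fun x => (`|u x - mean mu B u| `^ ps)%:E) `^ ps^-1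
                 <= (Cmean s p * (r / L) * b `^ (- p^-1) * L `^ (1 - s / p))%:E
                      * Lpnorm mu sB p g)%E) &
            (1 <= p ->
              let s' := s / (s - 1) in
              (avg mu B (fun x => (`|u x - mean mu B u| `^ ps)%:E) `^ ps^-1
                 <= (Csharp s * (r / L + ((s - 1) / (s - p)) `^ s'^-1)
                       * b `^ (- p^-1) * L `^ (1 - s / p))%:E
                      * Lpnorm mu sB p g)%E)]),
      (p = s ->
        (1 < s -> (0 < Lpnorm mu sB s g)%E ->
          (avg mu B (fun x =>
             (expR (cexp s * (L / r * (b `^ s^-1 * `|u x - mean mu B u|
                                      / fine (Lpnorm mu sB s g)))
                             `^ (s / (s - 1))))%:E)
             <= (Cexp s)%:E)%E) /\
        (s <= 1 ->
          exists v : X -> R,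
            [/\ representative mu B u v,
                unif_continuous_on B v &
                (osc B v <= (Cosc1 s * (r / L) * b `^ (- s^-1))%:E
                              * Lpnorm mu sB s g)%E])) &
      (s < p ->
        exists v : X -> R,
          [/\ representative mu B u v,
              hoelder_continuous_on B (1 - s / p) v,
              (osc B v <= (Cosc s p * (r / L) * b `^ (- p^-1)
                             * L `^ (1 - s / p))%:E * Lpnorm mu sB p g)%E &
              forall x y : X, B x -> B y ->
                ((`|v x - v y|)%:E <=
                   (Chol s p * (r / L) * b `^ (- p^-1)
                      * mdist x y `^ (1 - s / p))%:E * Lpnorm mu sB p g)%E])].
Proof.
exists inf_cst, mean_cst, osc_cst, osc_cst, sharp_cst, exp_rate, exp_cst,
  critical_osc_cst.
split; first by move=> s p; split; rewrite ltr_wpDr.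
split.
  move=> s; split; try by rewrite ltr_wpDr.
    by rewrite divr_gt0 ?powR_gt0 ?ltr_wpDr// ln_gt0// ltr1n.
  by rewrite /exp_cst /weight_cst !mulr_gt0 ?powR_gt0// addr_gt0// powR_gt0.
move=> d X mu [_ mfin] p sigma z r s b Ro p0 sigma12 r0 s0 b0 Ro0 B sB L mass.
move=> u g [[mesu _] _] [mg g0 [N [_ negN ugN]]] [_ goo].
have [n [n0 nE gG]] := Lpnorm_integral mu sB p g p0 goo.
have L0 : 0 < L by exact: L_gt0.
have Gpos G : n < G -> 0 < G by exact: le_lt_trans.
have rL0 : 0 <= r / L by rewrite divr_ge0 ?ltW.
(* The constants of the inf, mean, sharp and oscillation bounds unfold to 1 + |c|; a = 0 covers
   coefficients without a power of L. *)
have coef0 (c w q t a : R) : 0 <= w -> 0 <= (1 + `|c|) * w * b `^ q * t `^ a.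
  by move=> w0; rewrite !(mulr_ge0 _ (powR_ge0 _ _))// mulr_ge0// addr_ge0.
have Bz : B z by exact: ballxx.
have BDB : B `\` N `<=` B by move=> x [].
have dense x e : B x -> 0 < e -> exists2 y, (B `\` N) y & mdist x y < e.
  by move=> Bx e0; apply: (dense_setD mu z r N).
have repr v : (forall x, (B `\` N) x -> v x = u x) -> representative mu B u v.
  by move=> vu; exact: (ae_setD mu B N negN (fun x => v x = u x)).
have le_lim (c C : R) : 0 <= C -> (forall G, n < G -> c <= C * G) -> c <= C * n.
  by move=> C0 h; rewrite -lee_fin; apply: le_limit => // G /h; rewrite lee_fin.
have n1 : n < n + 1 by rewrite ltrDl.
(* v is built once, with G = n + 1. It inherits every modulus of u on B \ N, in particular those
   proved for each G > n. *)
have ext : s < p \/ (p = s /\ s <= 1) -> exists v, [/\ representative mu B u v,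
    unif_continuous_on B v & forall t e,
    (forall x y, (B `\` N) x -> (B `\` N) y -> mdist x y < t -> `|u x - u y| <= e) ->
    forall x y, B x -> B y -> mdist x y < t -> `|v x - v y| <= e].
  move=> sp; have ucu := unif_continuous_setD mu z r sigma s b Ro p (n + 1) u g N
    sigma12 r0 s0 b0 Ro0 p0 (Gpos _ n1) mass mg g0 negN ugN (gG _ (ltW n1)) sp.
  have [v [vu vle]] := dense_extension B (B `\` N) u BDB dense ucu.
  exists v; split => //; first exact: repr.
  by apply: unif_continuous_onP => e /ucu[t t0 /vle]; exists t.
rewrite nE; split.
- move=> ps; cbv zeta; split.
  + rewrite -EFinM; apply: le_limit.
      exact: coef0.
    move=> G nG; apply: (inf_avg_le mu z r sigma s b Ro p G u g N) => //.
      exact: Gpos nG.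
    exact/gG/ltW.
  + move=> ps1; rewrite -EFinM; apply: le_limit.
      exact: coef0.
    move=> G nG; apply: (mean_avg_le mu z r sigma s b Ro p G u g N) => //.
      exact: Gpos nG.
    exact/gG/ltW.
  + move=> p1; rewrite -EFinM; apply: le_limit.
      by apply: coef0; rewrite addr_ge0// powR_ge0.
    move=> G nG; apply: (sharp_avg_le mu z r sigma s b Ro p G u g N) => //.
    - exact: Gpos nG.
    - exact/gG/ltW.
    - by rewrite p1.
- move=> ps; rewrite -ps nE; split.
  (* The norm n is positive here, so G = n is admissible. *)
  + rewrite lte_fin => s1 n0'; rewrite ps.
    apply: (exp_avg_le mu z r sigma s b Ro p n u g N) => //.
      exact: gG.
    by rewrite -ps.
  + rewrite ps => s1; have [|v [rv uv vle]] := ext; first by right; rewrite ps.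
    exists v; split => //.
    rewrite -EFinM; apply: osc_le; first by exists z.
    move=> x y Bx By; apply: le_lim => [|G nG].
      by have := coef0 (level_cst s s * (10 * radii_cst s `^ s^-1 + 4)) (r / L)
        (- s^-1) L 0 rL0; rewrite powRr0 mulr1.
    (* The bound on u does not depend on the pair of points, so any [t] above their distance
       serves. *)
    apply: (vle (mdist x y + 1)) => //; last by rewrite ltrDl.
    move=> x' y' Dx' Dy' _.
    apply: (critical_osc_le mu z r sigma s b Ro p G u g N) => //.
      exact: Gpos nG.
    exact/gG/ltW.
- move=> sp; have [|v [rv uv vle]] := ext; first by left.
  have a0 : 0 < 1 - s / p by rewrite subr_gt0 ltr_pdivrMr// mul1r.
  have a1 : 1 - s / p <= 1 by rewrite gerBl divr_ge0 ?ltW.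
  have hoelder x y : B x -> B y -> `|v x - v y| <=
      osc_cst s p * (r / L) * b `^ (- p^-1) * mdist x y `^ (1 - s / p) * n.
    move=> Bx By; have [->|xy] := eqVneq x y.
      by rewrite subrr normr0; apply: mulr_ge0 => //; exact: coef0.
    have d0 : 0 < mdist x y by rewrite mdist_gt0.
    apply: le_lim; first exact: coef0.
    move=> G nG; have G0 := Gpos G nG.
    (* [vle] asks for a distance strictly below [t]. So [t] is lam d(x,y) with lam > 1, which needs
       x <> y; the cost lam^(1 - s/p) is at most lam, and lam tends to 1. *)
    rewrite -lee_fin -[X in (_ <= X%:E)%E]mulr1.
    apply: le_limit => [|lam lam1].
      by apply: mulr_ge0; [exact: coef0|exact: ltW].
    have lam0 : 0 < lam by exact: lt_trans lam1.
    rewrite lee_fin; apply: (vle (mdist x y * lam)) => //; last by rewrite ltr_pMr.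
    move=> x' y' Dx' Dy' xy'.
    apply: (le_trans (supercritical_hoelder_le mu z r sigma s b Ro p G u g N
      sigma12 r0 s0 b0 Ro0 p0 G0 mass mg g0 negN ugN (gG _ (ltW nG)) sp
      _ _ Dx' Dy')).
    rewrite [leRHS]mulrAC; apply: ler_wpM2r; first exact: ltW.
    rewrite -[leRHS]mulrA; apply: ler_wpM2l.
      by have := coef0 (level_cst s p * (10 * (1 - 2 `^ (1 - p / s))^-1 + 4)) (r / L)
        (- p^-1) L 0 rL0; rewrite powRr0 mulr1.
    apply: (@le_trans _ _ ((mdist x y * lam) `^ (1 - s / p))).
      by apply: ler_powRl; [exact: ltW|exact: mdist_ge0|exact: ltW].
    rewrite powRM ?mdist_ge0 ?(ltW lam0)// ler_wpM2l ?powR_ge0//.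
    by rewrite ler1_powR// ltW.
  exists v; split; first exact: rv.
  + exists (osc_cst s p * (r / L) * b `^ (- p^-1) * n) => x y Bx By.
    by rewrite mulrAC; exact: hoelder.
  + rewrite -EFinM; apply: osc_le; first by exists z.
    move=> x y Bx By; apply: le_lim => [|G nG]; first exact: coef0.
    apply: (vle (mdist x y + 1)) => //; last by rewrite ltrDl.
    move=> x' y' Dx' Dy' _.
    apply: (supercritical_osc_le mu z r sigma s b Ro p G u g N) => //.
      exact: Gpos nG.
    exact/gG/ltW.
  + by move=> x y Bx By; rewrite -EFinM lee_fin; exact: hoelder.
Qed.
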